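(* Let $(\mathcal T_i,f_{ij}:\mathcal T_i\to\mathcal T_j)_{i\in I}$ be a filtered diagram in $tt\mathcal{C}at$, with colimit $\mathcal T$ and canonical functors $f_i:\mathcal T_i\to\mathcal T$. Then the induced map $$\varphi:=\varprojlim_i f_i^{-1}:\mathrm{Spc}(\mathcal T)\to\varprojlim_i\mathrm{Spc}(\mathcal T_i)$$ is a homeomorphism.
   Context: A tt-category is a triangulated category with a compatible symmetric unital monoidal structure whose product $\otimes$ is exact in each variable; a tt-functor is an exact symmetric unital monoidal functor. $tt\mathcal{C}at$ is the category of small tt-categories and tt-functors where all structure is strict (e.g. tt-functors preserve the tensor product and translation functor on the nose). Filtered colimits in $tt\mathcal{C}at$ exist and are created by the forgetful functor to the category of small categories. A tt-ideal of $\mathcal T$ is a thick subcategory $\mathcal I$ with $\mathcal T\otimes\mathcal I\subset\mathcal I$; it is prime if it is proper and $a\otimes b\in\mathcal I$ implies $a\in\mathcal I$ or $b\in\mathcal I$. $\mathrm{Spc}(\mathcal T)$ is the set of prime tt-ideals with the topology with open basis $U(a)=\{\mathfrak P\mid a\in\mathfrak P\}$, $a\in\mathcal T$. A tt-functor $F$ induces a continuous map $\mathfrak P\mapsto F^{-1}(\mathfrak P)$ on $\mathrm{Spc}$; the limit is taken in topological spaces along the maps $f_{ij}^{-1}$, and $\varphi(\mathfrak P)=(f_i^{-1}(\mathfrak P))_i$. *)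

(* Defs.v *)
From HB Require Import structures.
From mathcomp Require Import all_boot.
From mathcomp Require Import all_classical topology.

Set Implicit Arguments.
Unset Strict Implicit.
Unset Printing Implicit Defensive.

Local Open Scope classical_set_scope.

Declare Scope tt_scope.
Delimit Scope tt_scope with tt.
Local Open Scope tt_scope.

(** Small categories are given by a type of objects and a single type of
    morphisms with source and target maps. Strict functors are required to
    preserve operations on the nose, which in this presentation are plain
    equalities, without transport along equalities of objects.
    Operations on morphisms that only make sense for composable (or parallel)
    pairs are total functions whose values elsewhere are irrelevant: every axiom
    about them, and every preservation property, is restricted to the meaningful
    arguments. *)

Record category := Category {
  Ob : Type;
  Mor : Type;
  dom : Mor -> Ob;
  cod : Mor -> Ob;
  idm : Ob -> Mor;
  comp : Mor -> Mor -> Mor;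
  dom_idm : forall a, dom (idm a) = a;
  cod_idm : forall a, cod (idm a) = a;
  dom_comp : forall g f, dom g = cod f -> dom (comp g f) = dom f;
  cod_comp : forall g f, dom g = cod f -> cod (comp g f) = cod g;
  comp_idl : forall f, comp (idm (cod f)) f = f;
  comp_idr : forall f, comp f (idm (dom f)) = f;
  compA : forall h g f, dom h = cod g -> dom g = cod f ->
    comp h (comp g f) = comp (comp h g) f }.

Arguments dom {c} _.
Arguments cod {c} _.
Arguments idm {c} _.
Arguments comp {c} _ _.

Notation "g ∘ f" := (comp g f) (at level 40, left associativity) : tt_scope.

Definition hom (C : category) (a b : Ob C) : set (Mor C) :=
  [set f | dom f = a /\ cod f = b].

Definition inverse (C : category) (f g : Mor C) : Prop :=
  [/\ dom g = cod f, cod g = dom f, g ∘ f = idm (dom f)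
    & f ∘ g = idm (cod f)].

Definition isom (C : category) (a b : Ob C) : set (Mor C) :=
  [set f | hom a b f /\ exists g, inverse f g].

Record functor (C D : category) := Functor {
  fob : Ob C -> Ob D;
  fmor : Mor C -> Mor D;
  dom_fmor : forall f, dom (fmor f) = fob (dom f);
  cod_fmor : forall f, cod (fmor f) = fob (cod f);
  fmor_idm : forall a, fmor (idm a) = idm (fob a);
  fmor_comp : forall g f, dom g = cod f -> fmor (g ∘ f) = fmor g ∘ fmor f }.

Definition fully_faithful (C D : category) (F : functor C D) : Prop :=
  forall a b h, hom (fob F a) (fob F b) h ->
    exists! f, hom a b f /\ fmor F f = h.

Definition essentially_surjective (C D : category) (F : functor C D) : Prop :=
  forall b, exists a, exists f, isom (fob F a) b f.

Definition equivalence (C D : category) (F : functor C D) : Prop :=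
  fully_faithful F /\ essentially_surjective F.

Definition parallel (C : category) (f g : Mor C) : Prop :=
  dom f = dom g /\ cod f = cod g.

Record preaddcat := PreAddCat {
  pa_cat :> category;
  zerom : Ob pa_cat -> Ob pa_cat -> Mor pa_cat;
  addm : Mor pa_cat -> Mor pa_cat -> Mor pa_cat;
  oppm : Mor pa_cat -> Mor pa_cat;
  hom_zerom : forall a b, hom a b (zerom a b);
  hom_addm : forall f g, parallel f g -> hom (dom f) (cod f) (addm f g);
  hom_oppm : forall f, hom (dom f) (cod f) (oppm f);
  addmA : forall f g h, parallel f g -> parallel g h ->
    addm f (addm g h) = addm (addm f g) h;
  addmC : forall f g, parallel f g -> addm f g = addm g f;
  add0m : forall f, addm (zerom (dom f) (cod f)) f = f;
  addNm : forall f, addm (oppm f) f = zerom (dom f) (cod f);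
  comp_addl : forall g g' f, parallel g g' -> dom g = cod f ->
    addm g g' ∘ f = addm (g ∘ f) (g' ∘ f);
  comp_addr : forall g f f', parallel f f' -> dom g = cod f ->
    g ∘ addm f f' = addm (g ∘ f) (g ∘ f') }.

Arguments zerom {p} _ _.
Arguments addm {p} _ _.
Arguments oppm {p} _.

Definition zero_object (C : preaddcat) : set (Ob C) :=
  [set z | idm z = zerom z z].

Record biproduct_maps (C : preaddcat) (a b s : Ob C) (i1 i2 p1 p2 : Mor C)
    : Prop := BiproductMaps {
  hom_i1 : hom a s i1;
  hom_i2 : hom b s i2;
  hom_p1 : hom s a p1;
  hom_p2 : hom s b p2;
  p1_i1 : p1 ∘ i1 = idm a;
  p2_i2 : p2 ∘ i2 = idm b;
  p1_i2 : p1 ∘ i2 = zerom b a;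
  p2_i1 : p2 ∘ i1 = zerom a b;
  i_p : addm (i1 ∘ p1) (i2 ∘ p2) = idm s }.

Definition biproduct (C : preaddcat) (a b s : Ob C) : Prop :=
  exists i1 i2 p1 p2, biproduct_maps a b s i1 i2 p1 p2.

Record addcat := AddCat {
  ac_preadd :> preaddcat;
  ac_zero : exists z : Ob ac_preadd, zero_object z;
  ac_biproduct : forall a b : Ob ac_preadd, exists s, biproduct a b s }.

Definition additive_functor (C D : preaddcat) (F : functor C D) : Prop :=
  forall f g, parallel f g -> fmor F (addm f g) = addm (fmor F f) (fmor F g).

Definition triangle (C : category) (S : functor C C) (u v w : Mor C) : Prop :=
  [/\ cod u = dom v, cod v = dom w & cod w = fob S (dom u)].

Record triangle_iso (C : category) (S : functor C C) (u v w u' v' w' : Mor C)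
    (f g h : Mor C) : Prop := TriangleIso {
  ti_f : isom (dom u) (dom u') f;
  ti_g : isom (dom v) (dom v') g;
  ti_h : isom (dom w) (dom w') h;
  ti_fg : g ∘ u = u' ∘ f;
  ti_gh : h ∘ v = v' ∘ g;
  ti_hf : fmor S f ∘ w = w' ∘ h }.

(* The translation functor is only required to be an auto-equivalence, which
   includes the case of an automorphism. *)
Record triangulated (C : addcat) (S : functor C C)
    (dist : Mor C -> Mor C -> Mor C -> Prop) : Prop := Triangulated {
  tr_susp_additive : additive_functor S;
  tr_susp_equiv : equivalence S;
  tr_triangle : forall u v w, dist u v w -> triangle S u v w;
  tr_iso : forall u v w u' v' w' f g h,
    dist u v w -> triangle S u' v' w' ->
    triangle_iso S u v w u' v' w' f g h -> dist u' v' w';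
  tr_id : forall a z, zero_object z ->
    dist (idm a) (zerom a z) (zerom z (fob S a));
  tr_cone : forall u, exists v w, dist u v w;
  tr_rot : forall u v w, triangle S u v w ->
    (dist u v w <-> dist v w (oppm (fmor S u)));
  tr_mor : forall u v w u' v' w' f g,
    dist u v w -> dist u' v' w' ->
    hom (dom u) (dom u') f -> hom (dom v) (dom v') g -> g ∘ u = u' ∘ f ->
    exists h, [/\ hom (dom w) (dom w') h, h ∘ v = v' ∘ g
                & fmor S f ∘ w = w' ∘ h];
  tr_octahedron : forall u v j k l i m n,
    dom v = cod u ->
    dist u j k -> dist v l i -> dist (v ∘ u) m n ->
    exists f g,
      [/\ dist f g (fmor S j ∘ i),
          f ∘ j = m ∘ v, n ∘ f = k, g ∘ m = l & i ∘ g = fmor S u ∘ n] }.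

Record tricat := TriCat {
  tc_add :> addcat;
  susp : functor tc_add tc_add;
  dist : Mor tc_add -> Mor tc_add -> Mor tc_add -> Prop;
  tc_axioms : triangulated susp dist }.

Arguments susp {t}.
Arguments dist {t} _ _ _.

Record tensor_data (C : category) := TensorData {
  tens : Ob C -> Ob C -> Ob C;
  tensm : Mor C -> Mor C -> Mor C;
  unit_ob : Ob C;
  assoc : Ob C -> Ob C -> Ob C -> Mor C;
  lunit : Ob C -> Mor C;
  runit : Ob C -> Mor C;
  braid : Ob C -> Ob C -> Mor C }.

Record symmetric_monoidal (C : category) (X : tensor_data C) : Prop :=
    SymmetricMonoidal {
  hom_tensm : forall f g,
    hom (tens X (dom f) (dom g)) (tens X (cod f) (cod g)) (tensm X f g);
  tensm_idm : forall a b, tensm X (idm a) (idm b) = idm (tens X a b);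
  tensm_comp : forall g f g' f', dom g = cod f -> dom g' = cod f' ->
    tensm X (g ∘ f) (g' ∘ f') = tensm X g g' ∘ tensm X f f';
  isom_assoc : forall a b c,
    isom (tens X (tens X a b) c) (tens X a (tens X b c)) (assoc X a b c);
  isom_lunit : forall a, isom (tens X (unit_ob X) a) a (lunit X a);
  isom_runit : forall a, isom (tens X a (unit_ob X)) a (runit X a);
  isom_braid : forall a b, isom (tens X a b) (tens X b a) (braid X a b);
  nat_assoc : forall f g h,
    assoc X (cod f) (cod g) (cod h) ∘ tensm X (tensm X f g) h
    = tensm X f (tensm X g h) ∘ assoc X (dom f) (dom g) (dom h);
  nat_lunit : forall f,
    lunit X (cod f) ∘ tensm X (idm (unit_ob X)) f = f ∘ lunit X (dom f);
  nat_runit : forall f,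
    runit X (cod f) ∘ tensm X f (idm (unit_ob X)) = f ∘ runit X (dom f);
  nat_braid : forall f g,
    braid X (cod f) (cod g) ∘ tensm X f g
    = tensm X g f ∘ braid X (dom f) (dom g);
  pentagon : forall a b c d,
    tensm X (idm a) (assoc X b c d) ∘ assoc X a (tens X b c) d
      ∘ tensm X (assoc X a b c) (idm d)
    = assoc X a b (tens X c d) ∘ assoc X (tens X a b) c d;
  unit_triangle : forall a b,
    tensm X (idm a) (lunit X b) ∘ assoc X a (unit_ob X) b
    = tensm X (runit X a) (idm b);
  hexagon : forall a b c,
    assoc X b c a ∘ braid X a (tens X b c) ∘ assoc X a b c
    = tensm X (idm b) (braid X a c) ∘ assoc X b a c
      ∘ tensm X (braid X a b) (idm c);
  braid_sym : forall a b, braid X b a ∘ braid X a b = idm (tens X a b) }.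

(* The functors [- ⊗ b] and [a ⊗ -] are exact by means of isomorphisms
   [sl a b : Σa ⊗ b -> Σ(a ⊗ b)] and [sr a b : a ⊗ Σb -> Σ(a ⊗ b)], natural in
   both variables. They are part of the structure, so that strict tt-functors
   preserve them. *)
Record biexact (C : tricat) (X : tensor_data C)
    (sl sr : Ob C -> Ob C -> Mor C) : Prop := Biexact {
  tensm_addl : forall f f' g, parallel f f' ->
    tensm X (addm f f') g = addm (tensm X f g) (tensm X f' g);
  tensm_addr : forall f g g', parallel g g' ->
    tensm X f (addm g g') = addm (tensm X f g) (tensm X f g');
  isom_sl : forall a b,
    isom (tens X (fob susp a) b) (fob susp (tens X a b)) (sl a b);
  isom_sr : forall a b,
    isom (tens X a (fob susp b)) (fob susp (tens X a b)) (sr a b);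
  nat_sl : forall f g,
    sl (cod f) (cod g) ∘ tensm X (fmor susp f) g
    = fmor susp (tensm X f g) ∘ sl (dom f) (dom g);
  nat_sr : forall f g,
    sr (cod f) (cod g) ∘ tensm X f (fmor susp g)
    = fmor susp (tensm X f g) ∘ sr (dom f) (dom g);
  dist_tensl : forall u v w b, dist u v w ->
    dist (tensm X u (idm b)) (tensm X v (idm b))
         (sl (dom u) b ∘ tensm X w (idm b));
  dist_tensr : forall a u v w, dist u v w ->
    dist (tensm X (idm a) u) (tensm X (idm a) v)
         (sr a (dom u) ∘ tensm X (idm a) w) }.

Record ttcat := TTCat {
  tt_tri :> tricat;
  tt_tens : tensor_data tt_tri;
  suspl : Ob tt_tri -> Ob tt_tri -> Mor tt_tri;
  suspr : Ob tt_tri -> Ob tt_tri -> Mor tt_tri;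
  tt_monoidal : symmetric_monoidal tt_tens;
  tt_biexact : biexact tt_tens suspl suspr }.

Arguments suspl {t} _ _.
Arguments suspr {t} _ _.

Notation "a ⊗ b" := (tens (tt_tens _) a b)
  (at level 40, left associativity) : tt_scope.
Notation "f ⊗m g" := (tensm (tt_tens _) f g)
  (at level 40, left associativity) : tt_scope.
Notation "𝟙" := (unit_ob (tt_tens _)) : tt_scope.

Record ttfunctor (S T : ttcat) := TTFunctor {
  tf_fun :> functor S T;
  tf_add : additive_functor tf_fun;
  tf_susp : forall a, fob tf_fun (fob susp a) = fob susp (fob tf_fun a);
  tf_suspm : forall f, fmor tf_fun (fmor susp f) = fmor susp (fmor tf_fun f);
  tf_dist : forall u v w, dist u v w ->
    dist (fmor tf_fun u) (fmor tf_fun v) (fmor tf_fun w);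
  tf_tens : forall a b, fob tf_fun (a ⊗ b) = fob tf_fun a ⊗ fob tf_fun b;
  tf_tensm : forall f g, fmor tf_fun (f ⊗m g) = fmor tf_fun f ⊗m fmor tf_fun g;
  tf_unit : fob tf_fun 𝟙 = 𝟙;
  tf_assoc : forall a b c, fmor tf_fun (assoc (tt_tens S) a b c)
    = assoc (tt_tens T) (fob tf_fun a) (fob tf_fun b) (fob tf_fun c);
  tf_lunit : forall a,
    fmor tf_fun (lunit (tt_tens S) a) = lunit (tt_tens T) (fob tf_fun a);
  tf_runit : forall a,
    fmor tf_fun (runit (tt_tens S) a) = runit (tt_tens T) (fob tf_fun a);
  tf_braid : forall a b, fmor tf_fun (braid (tt_tens S) a b)
    = braid (tt_tens T) (fob tf_fun a) (fob tf_fun b);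
  tf_suspl : forall a b,
    fmor tf_fun (suspl a b) = suspl (fob tf_fun a) (fob tf_fun b);
  tf_suspr : forall a b,
    fmor tf_fun (suspr a b) = suspr (fob tf_fun a) (fob tf_fun b) }.

Record filtered (I : category) : Prop := Filtered {
  filt_inhabited : exists i : Ob I, True;
  filt_ob : forall i j : Ob I, exists k e e', hom i k e /\ hom j k e';
  filt_mor : forall (i j : Ob I) e e', hom i j e -> hom i j e' ->
    exists k h, hom j k h /\ h ∘ e = h ∘ e' }.

(* A functor from [I] to the category of tt-categories and strict tt-functors.
   [dg_mor] takes the proof that [e] goes from [i] to [j], so that its type is
   stated without transport; the laws hold for all such proofs. *)
Record diagram (I : category) := Diagram {
  dg_ob :> Ob I -> ttcat;
  dg_mor : forall i j e, hom i j e -> ttfunctor (dg_ob i) (dg_ob j);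
  dg_id_ob : forall i (h : hom i i (idm i)) a, fob (dg_mor h) a = a;
  dg_id_mor : forall i (h : hom i i (idm i)) f, fmor (dg_mor h) f = f;
  dg_comp_ob : forall i j k e e' (h : hom i j e) (h' : hom j k e')
    (h'' : hom i k (e' ∘ e)) a,
    fob (dg_mor h'') a = fob (dg_mor h') (fob (dg_mor h) a);
  dg_comp_mor : forall i j k e e' (h : hom i j e) (h' : hom j k e')
    (h'' : hom i k (e' ∘ e)) f,
    fmor (dg_mor h'') f = fmor (dg_mor h') (fmor (dg_mor h) f) }.

Record cocone (I : category) (D : diagram I) (T : ttcat) := Cocone {
  cc_fun :> forall i, ttfunctor (D i) T;
  cc_ob : forall i j e (h : hom i j e) a,
    fob (cc_fun j) (fob (dg_mor D h) a) = fob (cc_fun i) a;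
  cc_mor : forall i j e (h : hom i j e) f,
    fmor (cc_fun j) (fmor (dg_mor D h) f) = fmor (cc_fun i) f }.

Definition factors (I : category) (D : diagram I) (T S : ttcat)
    (f : cocone D T) (g : cocone D S) (H : ttfunctor T S) : Prop :=
  forall i, (forall a, fob H (fob (f i) a) = fob (g i) a)
         /\ (forall m, fmor H (fmor (f i) m) = fmor (g i) m).

Definition is_colimit (I : category) (D : diagram I) (T : ttcat)
    (f : cocone D T) : Prop :=
  forall (S : ttcat) (g : cocone D S),
    (exists H : ttfunctor T S, factors f g H) /\
    (forall H H' : ttfunctor T S, factors f g H -> factors f g H' ->
       fob H =1 fob H' /\ fmor H =1 fmor H').

Record thick (T : tricat) (J : set (Ob T)) : Prop := Thick {
  thick_zero : forall z, zero_object z -> J z;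
  thick_iso : forall a b f, isom a b f -> J a -> J b;
  thick_susp : forall a, J (fob susp a) <-> J a;
  thick_cone : forall u v w, dist u v w ->
    J (dom u) -> J (cod u) -> J (cod v);
  thick_summand : forall a b s, biproduct a b s -> J s -> J a /\ J b }.

Record ttideal (T : ttcat) (J : set (Ob T)) : Prop := TTIdeal {
  ideal_thick : thick J;
  ideal_tens : forall a b, J b -> J (a ⊗ b) }.

Record prime_ideal (T : ttcat) (P : set (Ob T)) : Prop := PrimeIdeal {
  prime_ttideal : ttideal P;
  prime_proper : exists a, ~ P a;
  prime_tens : forall a b, P (a ⊗ b) -> P a \/ P b }.

Record Spc (T : ttcat) := MkSpc {
  spc_set :> set (Ob T);
  spc_prime : prime_ideal spc_set }.

Lemma Spc_ext (T : ttcat) (P Q : Spc T) : spc_set P = spc_set Q -> P = Q.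
Proof.
case: P Q => [P hP] [Q hQ] /= PQ; case: Q / PQ hQ => hQ.
by rewrite (Prop_irrelevance hP hQ).
Qed.

Section Homs.
Context {C : preaddcat}.
Implicit Types (a b c d : Ob C) (f g h : Mor C).

Lemma hom_idm a : hom a a (idm a).
Proof. by split; [exact: dom_idm | exact: cod_idm]. Qed.

Lemma hom_comp a b c g f : hom b c g -> hom a b f -> hom a c (g ∘ f).
Proof.
move=> [g1 g2] [f1 f2]; split.
  by rewrite dom_comp// g1 f2.
by rewrite cod_comp// g1 f2.
Qed.

Lemma hom_compA a b c d h g f : hom c d h -> hom b c g -> hom a b f ->
  h ∘ (g ∘ f) = h ∘ g ∘ f.
Proof. by move=> [h1 _] [g1 g2] [_ f2]; rewrite compA// ?h1 ?g1. Qed.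

Lemma hom_idl a b f : hom a b f -> idm b ∘ f = f.
Proof. by move=> [_ <-]; exact: comp_idl. Qed.

Lemma hom_idr a b f : hom a b f -> f ∘ idm a = f.
Proof. by move=> [<- _]; exact: comp_idr. Qed.

Lemma hom_parallel a b f g : hom a b f -> hom a b g -> parallel f g.
Proof. by move=> [f1 f2] [g1 g2]; split; rewrite ?f1 ?f2 ?g1 ?g2. Qed.

Lemma hom_add a b f g : hom a b f -> hom a b g -> hom a b (addm f g).
Proof.
move=> hf hg; have := hom_addm (hom_parallel hf hg).
by case: hf => -> ->.
Qed.

Lemma hom_opp a b f : hom a b f -> hom a b (oppm f).
Proof. by move=> [<- <-]; exact: hom_oppm. Qed.

Lemma hom_add0 a b f : hom a b f -> addm (zerom a b) f = f.
Proof. by move=> [<- <-]; exact: add0m. Qed.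

Lemma hom_addN a b f : hom a b f -> addm (oppm f) f = zerom a b.
Proof. by move=> [<- <-]; exact: addNm. Qed.

Lemma hom_add_idem a b f : hom a b f -> addm f f = f -> f = zerom a b.
Proof.
move=> hf ff; have hN := hom_opp hf.
have : addm (oppm f) (addm f f) = zerom a b by rewrite ff (hom_addN hf).
rewrite addmA; [|exact: (hom_parallel hN hf)|exact: (hom_parallel hf hf)].
by rewrite (hom_addN hf) (hom_add0 hf).
Qed.

Lemma comp_zerol a b c f : hom a b f -> zerom b c ∘ f = zerom a c.
Proof.
move=> hf; have hz := hom_zerom b c.
apply: hom_add_idem; first exact: (hom_comp hz hf).
rewrite -comp_addl; [|exact: hom_parallel|by case: hz hf => -> _ [_ ->]].
by rewrite (hom_add0 hz).
Qed.

Lemma comp_zeror a b c g : hom b c g -> g ∘ zerom a b = zerom a c.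
Proof.
move=> hg; have hz := hom_zerom a b.
apply: hom_add_idem; first exact: (hom_comp hg hz).
rewrite -comp_addr; [|exact: hom_parallel|by case: hz hg => _ -> [->]].
by rewrite (hom_add0 hz).
Qed.

Lemma hom_addC a b f g : hom a b f -> hom a b g -> addm f g = addm g f.
Proof. by move=> hf hg; apply: addmC; exact: (hom_parallel hf hg). Qed.

Lemma hom_zero_idem a b f : hom a b f -> addm f (zerom a b) = f.
Proof.
by move=> hf; rewrite (hom_addC hf (hom_zerom a b)); exact: hom_add0.
Qed.

End Homs.

Section TriangleFacts.
Context {T : tricat}.
Implicit Types (a b c d s z : Ob T) (f g h u v w : Mor T).

Lemma hom_susp a b f :
  hom a b f -> hom (fob susp a) (fob susp b) (fmor susp f).
Proof. by move=> [<- <-]; split; [exact: dom_fmor | exact: cod_fmor]. Qed.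

Lemma susp_zerom a b :
  fmor susp (zerom a b) = zerom (fob susp a) (fob susp b).
Proof.
have hz := hom_zerom a b; apply: hom_add_idem; first exact: hom_susp.
by rewrite -(tr_susp_additive (tc_axioms T)) ?(hom_add0 hz).
Qed.

Lemma zero_object_susp z : zero_object z -> zero_object (fob susp z).
Proof. by move=> z0; rewrite /zero_object /= -fmor_idm z0 susp_zerom. Qed.

Lemma dist_zero_id z b : zero_object z ->
  dist (zerom z b) (idm b) (zerom b (fob susp z)).
Proof.
move=> z0; have [h1 h2] := hom_zerom z b.
have [k1 k2] := hom_zerom b (fob susp z).
apply: (tr_rot (tc_axioms T) _).2.
  by split; rewrite ?dom_idm ?cod_idm ?k1 ?k2 ?h1 ?h2.
have -> : oppm (fmor susp (zerom z b)) = zerom (fob susp z) (fob susp b).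
  have hS := hom_susp (hom_zerom z b); have := hom_addN hS.
  by rewrite susp_zerom in hS *; rewrite (hom_zero_idem (hom_opp hS)).
by apply: (tr_id (tc_axioms T)); exact: zero_object_susp.
Qed.

Lemma dist_rot u v w : dist u v w -> dist v w (oppm (fmor susp u)).
Proof.
move=> uvw; have tri := tr_triangle (tc_axioms T) uvw.
exact: (tr_rot (tc_axioms T) tri).1.
Qed.

Lemma dist_comp0 u v w : dist u v w -> v ∘ u = zerom (dom u) (cod v).
Proof.
move=> uvw; have [h1 h2 h3] := tr_triangle (tc_axioms T) uvw.
have [z z0] := ac_zero T; set a := dom u.
have hf : hom (dom (idm a)) (dom u) (idm a) by rewrite dom_idm; exact: hom_idm.
have hg : hom (dom (zerom a z)) (dom v) u by rewrite (hom_zerom a z).1.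
have sq : u ∘ idm a = u ∘ idm a by [].
have [h [hh e _]] :=
  tr_mor (tc_axioms T) (tr_id (tc_axioms T) a z0) uvw hf hg sq.
rewrite -e h2; apply: comp_zeror.
by move: hh; rewrite (hom_zerom z (fob susp a)).1.
Qed.

Lemma dist_factor u v w f b : dist u v w -> hom (cod u) b f ->
  f ∘ u = zerom (dom u) b -> exists2 q, hom (cod v) b q & q ∘ v = f.
Proof.
move=> uvw hf fu0; have [h1 h2 h3] := tr_triangle (tc_axioms T) uvw.
have [z z0] := ac_zero T; set a := dom u.
have hz := hom_zerom a z; have hzb := hom_zerom z b.
have h0 : hom (dom u) (dom (zerom z b)) (zerom a z) by rewrite hzb.1.
have hf' : hom (dom v) (dom (idm b)) f by rewrite dom_idm -h1.
have sq : f ∘ u = zerom z b ∘ zerom a z by rewrite fu0 (comp_zerol _ hz).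
have [q [hq e _]] :=
  tr_mor (tc_axioms T) uvw (dist_zero_id b z0) h0 hf' sq.
exists q; first by rewrite h2 -(hom_zerom b (fob susp z)).1.
by rewrite e (hom_idl hf).
Qed.

Lemma thick_biproduct (J : set (Ob T)) a b s :
  thick J -> biproduct a b s -> J a -> J b -> J s.
Proof.
move=> tJ [i1 [i2 [p1 [p2 B]]]] Ja Jb.
have [hi1 hi2 hp1 hp2 e11 e22 e12 e21 ip] := B.
have [v [w uvw]] := tr_cone (tc_axioms T) i1.
have [h1 h2 h3] := tr_triangle (tc_axioms T) uvw.
have [d1 c1] := hi1; pose c := cod v; pose Sa := fob susp a.
have hv : hom s c v by split; rewrite // -h1 c1.
have hw : hom c Sa w by split; rewrite // h3 d1.
have hSi1 := hom_susp hi1; have hSp1 := hom_susp hp1.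
have [q hq qv] : exists2 q, hom c b q & q ∘ v = p2.
  by apply: (dist_factor uvw); [rewrite c1 | rewrite d1].
have vi1 : v ∘ i1 = zerom a c by rewrite (dist_comp0 uvw) d1.
have hvi2 : hom b c (v ∘ i2) := hom_comp hv hi2.
have w0 : w = zerom c Sa.
  have r3 := dist_comp0 (dist_rot (dist_rot uvw)).
  have cN : cod (oppm (fmor susp i1)) = fob susp s.
    by rewrite (hom_opp hSi1).2.
  rewrite cN in r3.
  have hN := hom_opp hSi1.
  have Sw0 : fmor susp i1 ∘ w = zerom c (fob susp s).
    have hSw := hom_comp hSi1 hw; have hNw := hom_comp hN hw.
    have : addm (oppm (fmor susp i1) ∘ w) (fmor susp i1 ∘ w)
         = zerom c (fob susp s).
      rewrite -comp_addl; last by rewrite hN.1 hw.2.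
        by rewrite (hom_addN hSi1) (comp_zerol _ hw).
      exact: (hom_parallel hN hSi1).
    by rewrite r3 hw.1 (hom_add0 hSw).
  have <- : fmor susp p1 ∘ (fmor susp i1 ∘ w) = w.
    rewrite (hom_compA hSp1 hSi1 hw) -fmor_comp ?e11 ?fmor_idm ?(hom_idl hw)//.
    by rewrite hp1.1 c1.
  by rewrite Sw0 (comp_zeror _ hSp1).
have vi2q : v ∘ i2 ∘ q = idm c.
  have hg : hom c c (v ∘ i2 ∘ q) := hom_comp hvi2 hq.
  have gv : (v ∘ i2 ∘ q) ∘ v = v.
    rewrite -(hom_compA hvi2 hq hv) qv -(hom_compA hv hi2 hp2).
    have -> : v ∘ (i2 ∘ p2) = addm (v ∘ (i1 ∘ p1)) (v ∘ (i2 ∘ p2)).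
      rewrite (hom_compA hv hi1 hp1) vi1 (comp_zerol _ hp1).
      by rewrite (hom_add0 (hom_comp hv (hom_comp hi2 hp2))).
    rewrite -comp_addr ?ip ?(hom_idr hv)//.
      exact: (hom_parallel (hom_comp hi1 hp1) (hom_comp hi2 hp2)).
    by rewrite hv.1 (hom_comp hi1 hp1).2.
  pose g := addm (oppm (idm c)) (v ∘ i2 ∘ q).
  have hid := hom_idm c; have hNid := hom_opp hid.
  have hg' : hom c c g := hom_add hNid hg.
  have gv0 : g ∘ v = zerom s c.
    rewrite comp_addl; [|exact: (hom_parallel hNid hg)|by rewrite hNid.1 hv.2].
    rewrite gv -[X in addm _ X](hom_idl hv) -comp_addl.
    - by rewrite (hom_addN hid) (comp_zerol _ hv).
    - exact: (hom_parallel hNid hid).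
    - by rewrite hNid.1 hv.2.
  have [t ht tw] : exists2 t, hom Sa c t & t ∘ w = g.
    have := dist_factor (dist_rot uvw) (f := g) (b := c).
    rewrite hv.1 hw.2; apply => //.
  rewrite w0 (comp_zeror _ ht) in tw.
  have : addm (idm c) g = idm c by rewrite -tw (hom_zero_idem hid).
  rewrite /g addmA; [|exact: (hom_parallel hid hNid)|exact: (hom_parallel hNid hg)].
  by rewrite (hom_addC hid hNid) (hom_addN hid) (hom_add0 hg).
have Jc : J c.
  apply: (thick_iso tJ (f := v ∘ i2) (a := b)) => //; split=> //.
  exists q; split; rewrite ?hq.1 ?hq.2 ?hvi2.1 ?hvi2.2//.
  by rewrite (hom_compA hq hv hi2) qv.
have JSs : J (fob susp s).
  have := thick_cone tJ (dist_rot (dist_rot uvw)).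
  rewrite hw.1 hw.2 (hom_opp hSi1).2; apply => //.
  by apply/(thick_susp tJ).
by apply/(thick_susp tJ).
Qed.

End TriangleFacts.

Section SpcTopology.
Variable T : ttcat.

HB.instance Definition _ := gen_eqMixin (Spc T).
HB.instance Definition _ := gen_choiceMixin (Spc T).

Definition spcU (a : Ob T) : set (Spc T) := [set P | spc_set P a].

(* The sets [spcU a] form a base, and not only a subbase, because
   [spcU a `&` spcU b] is [spcU s] for [s] a biproduct of [a] and [b]. *)
Definition spc_open : set (set (Spc T)) :=
  [set O | forall P, O P -> exists a, spcU a P /\ spcU a `<=` O].

Lemma spc_openT : spc_open setT.
Proof.
move=> P _; have [z z0] := ac_zero T; exists z; split=> //.
exact: thick_zero (ideal_thick (prime_ttideal (spc_prime P))) z z0.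
Qed.

Lemma spc_openI : setI_closed spc_open.
Proof.
move=> A B oA oB P [/oA[a [Pa aA]] /oB[b [Pb bB]]].
have [s abs] := ac_biproduct a b; exists s; split.
  by apply: (thick_biproduct _ abs) => //;
    exact: ideal_thick (prime_ttideal (spc_prime P)).
move=> Q Qs.
have [Qa Qb] :=
  thick_summand (ideal_thick (prime_ttideal (spc_prime Q))) abs Qs.
by split; [exact: aA | exact: bB].
Qed.

Lemma spc_open_bigU (I : Type) (f : I -> set (Spc T)) :
  (forall i, spc_open (f i)) -> spc_open (\bigcup_i f i).
Proof.
move=> of_ P [i _ /of_[a [Pa af]]]; exists a; split=> // Q /af fQ.
by exists i.
Qed.

HB.instance Definition _ :=
  isOpenTopological.Build (Spc T) spc_openT spc_openI spc_open_bigU.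

End SpcTopology.

Section SpcMap.
Variables (S T : ttcat) (F : ttfunctor S T).

Lemma hom_fmor a b f : hom a b f -> hom (fob F a) (fob F b) (fmor F f).
Proof. by move=> [<- <-]; split; [exact: dom_fmor | exact: cod_fmor]. Qed.

Lemma fmor_zerom a b : fmor F (zerom a b) = zerom (fob F a) (fob F b).
Proof.
have hz := hom_zerom a b; apply: hom_add_idem; first exact: hom_fmor.
by rewrite -(tf_add F) ?(hom_add0 hz).
Qed.

Lemma fob_zero_object z : zero_object z -> zero_object (fob F z).
Proof. by move=> z0; rewrite /zero_object /= -fmor_idm z0 fmor_zerom. Qed.

Lemma fmor_isom a b f : isom a b f -> isom (fob F a) (fob F b) (fmor F f).
Proof.
move=> [hf [g [g1 g2 gf fg]]]; split; first exact: hom_fmor.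
exists (fmor F g); split; rewrite ?dom_fmor ?cod_fmor ?g1 ?g2//.
  by rewrite -fmor_comp// gf fmor_idm.
by rewrite -fmor_comp// fg fmor_idm.
Qed.

Lemma fob_biproduct a b s :
  biproduct a b s -> biproduct (fob F a) (fob F b) (fob F s).
Proof.
move=> [i1 [i2 [p1 [p2 [hi1 hi2 hp1 hp2 e11 e22 e12 e21 ip]]]]].
exists (fmor F i1), (fmor F i2), (fmor F p1), (fmor F p2).
split; try exact: hom_fmor.
- by rewrite -fmor_comp ?e11 ?fmor_idm// hp1.1 hi1.2.
- by rewrite -fmor_comp ?e22 ?fmor_idm// hp2.1 hi2.2.
- by rewrite -fmor_comp ?e12 ?fmor_zerom// hp1.1 hi2.2.
- by rewrite -fmor_comp ?e21 ?fmor_zerom// hp2.1 hi1.2.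
- rewrite -!fmor_comp ?hi1.1 ?hp1.2 ?hi2.1 ?hp2.2// -(tf_add F).
    by rewrite ip fmor_idm.
  exact: (hom_parallel (hom_comp hi1 hp1) (hom_comp hi2 hp2)).
Qed.

Lemma preimage_prime (P : set (Ob T)) :
  prime_ideal P -> prime_ideal (fob F @^-1` P).
Proof.
move=> [[tP iP] [x nPx] pP]; split; first split; first split.
- by move=> z /fob_zero_object; exact: thick_zero tP _.
- by move=> a b f /fmor_isom; exact: (thick_iso tP).
- by move=> a; rewrite /preimage /= tf_susp; exact: thick_susp tP _.
- move=> u v w /(tf_dist F) d; have := thick_cone tP d.
  by rewrite !dom_fmor !cod_fmor.
- by move=> a b s /fob_biproduct; exact: (thick_summand tP).
- by move=> a b; rewrite /preimage /= tf_tens; exact: iP.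
- exists 𝟙; rewrite /preimage /= tf_unit => P1; apply: nPx.
  apply: (thick_iso tP (isom_runit (tt_monoidal T) x)); exact: iP.
- by move=> a b; rewrite /preimage /= tf_tens; exact: pP.
Qed.

Definition spc_map (P : Spc T) : Spc S := MkSpc (preimage_prime (spc_prime P)).

End SpcMap.

Section SpcLimit.
Variables (I : category) (D : diagram I).

Definition spc_lim : set (prod_topology (fun i : Ob I => Spc (D i))) :=
  [set x | forall i j e (h : hom i j e), spc_map (dg_mor D h) (x j) = x i].

Variables (T : ttcat) (f : cocone D T).

Lemma spc_cone_lim (P : Spc T) :
  spc_lim (fun i => spc_map (f i) P : Spc (D i)).
Proof.
move=> i j e h; apply: Spc_ext => /=; apply/funext => a.
by rewrite /preimage /= cc_ob.
Qed.

Definition spc_phi (P : Spc T) : set_type spc_lim :=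
  exist (fun x => x \in spc_lim) _ (mem_set (spc_cone_lim P)).

End SpcLimit.

Definition homeomorphism (X Y : topologicalType) (f : X -> Y) : Prop :=
  continuous f /\
  exists g : Y -> X, [/\ continuous g, cancel f g & cancel g f].

(* Main.v *)
Require Import Defs.
From mathcomp Require Import all_boot.
From mathcomp Require Import all_classical topology.

(** The filtered colimit can be built concretely: its objects, morphisms and
    distinguished triangles are germs of those of the [D i], since every axiom
    of a tt-category involves only finitely many data and equations, which all
    live at a common stage. By the universal property [T] is this colimit, so
    that objects, morphisms, equations and distinguished triangles of [T] come
    from some stage. Hence, for a compatible family of primes [x i], the union
    of their images in [T] is a prime ideal, whose preimage in [D i] is [x i];
    the map sending the family to this union is inverse to [spc_phi]. It is
    continuous because each basic open set of [Spc T] is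
    [spcU (fob (f i) a)], the pullback of a basic open set of [Spc (D i)]. *)

Set Implicit Arguments.
Unset Strict Implicit.
Unset Printing Implicit Defensive.

Local Open Scope classical_set_scope.
Local Open Scope tt_scope.

(** * Filtered colimits of types *)

Section FilteredColimits.
Variables (I : category) (I_filt : filtered I).
Implicit Types i j k l : Ob I.

(** The hypothesis [is_colimit] only speaks of tt-functors out of [T], never of single objects,
    equations or triangles of [T]. Such information is extracted by mapping [T] to a tt-category
    whose elements are understood, so the model by germs must carry the whole tt-structure,
    octahedron and coherence included. The obstacle throughout is partiality. Composites and sums
    are meaningful only for composable or parallel arguments, and between germs such a condition is
    an equation that becomes true only from some stage on. A typical argument therefore lifts the
    endpoint conditions, moves to a later stage, and uses the axioms there. Strictness is what makes
    this work: transition functors preserve all structure on the nose, so operations on germs are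
    well defined by plain equalities. Distinguished triangles must be traced back to a stage as
    well, because closure of a union of primes under cones depends on it. *)

Definition arr i j := {e : Mor I | hom i j e}.

Lemma arr_comp_proof i j k (v : arr j k) (u : arr i j) :
  hom i k (sval v ∘ sval u).
Proof.
case: v u => [e [e1 e2]] [e' [e1' e2']]; split=> /=.
  by rewrite dom_comp// e1.
by rewrite cod_comp// e1.
Qed.

Definition arr_comp i j k (v : arr j k) (u : arr i j) : arr i k :=
  exist _ _ (arr_comp_proof v u).

Lemma arr_ext i j (u v : arr i j) : sval u = sval v -> u = v.
Proof.
case: u v => [e p] [e' p'] /= ee'; case: e' / ee' p' => p'.
by rewrite (Prop_irrelevance p p').
Qed.

Lemma arr_compA i j k l (w : arr k l) (v : arr j k) (u : arr i j) :
  arr_comp w (arr_comp v u) = arr_comp (arr_comp w v) u.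
Proof.
apply: arr_ext => /=; case: w v u => [w [w1 w2]] [v [v1 v2]] [u [u1 u2]] /=.
by rewrite Defs.compA ?w1 ?v1.
Qed.

Definition arr_id i : arr i i :=
  exist _ (idm i) (conj (dom_idm i) (cod_idm i)).

Lemma arr_join i j : exists k (u : arr i k) (v : arr j k), True.
Proof.
have [k [e [e' [h h']]]] := filt_ob I_filt i j.
by exists k, (exist _ e h), (exist _ e' h').
Qed.

Lemma arr_coeq i j (u v : arr i j) :
  exists k (w : arr j k), arr_comp w u = arr_comp w v.
Proof.
have [k [h [hh e]]] := filt_mor I_filt (svalP u) (svalP v).
by exists k, (exist _ h hh); exact: arr_ext.
Qed.

Lemma arr_ore i j k (u : arr i j) (v : arr i k) :
  exists l (u' : arr j l) (v' : arr k l), arr_comp u' u = arr_comp v' v.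
Proof.
have [m [a [b _]]] := arr_join j k.
have [l [w e]] := arr_coeq (arr_comp a u) (arr_comp b v).
by exists l, (arr_comp w a), (arr_comp w b); rewrite -!arr_compA.
Qed.

Record sys := Sys {
  car :> Ob I -> Type;
  tr : forall i j, arr i j -> car i -> car j;
  tr_comp : forall i j k (v : arr j k) (u : arr i j) x,
    tr (arr_comp v u) x = tr v (tr u x) }.

Definition prod_sys (X Y : sys) : sys.
Proof.
exists (fun i => X i * Y i)%type (fun i j u x => (tr u x.1, tr u x.2)).
by move=> i j k v u x; rewrite !tr_comp.
Defined.

(** Filtered colimits are described by properties and not by a construction, so that operations
    extend both to germs and to the objects and morphisms of a category already known to be a
    colimit. *)
Record colimit_cone (X : sys) := ColimitCone {
  pt : Type;
  leg : forall i, X i -> pt;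
  leg_tr : forall i j (u : arr i j) x, leg (tr u x) = leg x;
  leg_surj : forall q, exists i x, q = leg (i := i) x;
  leg_sep : forall i j (x : X i) (y : X j), leg x = leg y ->
    exists k (u : arr i k) (v : arr j k), tr u x = tr v y }.

(** [leg_sep] may move the two elements along different arrows; coequalizing these gives one arrow
    for both. *)
Lemma leg_eq (X : sys) (c : colimit_cone X) i (x y : X i) :
  leg c x = leg c y -> exists j (u : arr i j), tr u x = tr u y.
Proof.
move=> /leg_sep[k [u [v uv]]]; have [l [w e]] := arr_coeq u v.
by exists l, (arr_comp w u); rewrite {2}e !tr_comp uv.
Qed.

(** Filtered colimits commute with finite products. Hence a finite tuple has representatives at one
    stage, and finitely many equations hold at one stage. *)
Definition prod_cone (X Y : sys) (c : colimit_cone X) (d : colimit_cone Y) :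
  colimit_cone (prod_sys X Y).
Proof.
exists (pt c * pt d)%type (fun i x => (leg c x.1, leg d x.2)).
- by move=> i j u x /=; rewrite !leg_tr.
- move=> [p q]; have [i [x ->]] := leg_surj p; have [j [y ->]] := leg_surj q.
  have [k [u [v _]]] := arr_join i j.
  by exists k, (tr u x, tr v y); rewrite /= !leg_tr.
- move=> i j [x x'] [y y'] /= [/leg_sep[k [u [v e]]] /leg_sep[k' [u' [v' e']]]].
  (* The coordinates agree at unrelated stages. The Ore square aligns the arrows out of [i], and a
     coequalizer then aligns those out of [j]. *)
  have [l [a [a' aa']]] := arr_ore u u'.
  have [m [w ww]] := arr_coeq (arr_comp a v) (arr_comp a' v').
  exists m, (arr_comp w (arr_comp a u)), (arr_comp w (arr_comp a v)).
  congr pair; first by rewrite /= !tr_comp e.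
  by rewrite /= aa' ww !tr_comp e'.
Defined.

Section Germs.
Variable X : sys.

Definition germ_rel (p q : {i & X i}) : Prop :=
  exists k (u : arr (tag p) k) (v : arr (tag q) k),
    tr u (tagged p) = tr v (tagged q).

Lemma germ_rel_sym p q : germ_rel p q -> germ_rel q p.
Proof. by move=> [k [u [v e]]]; exists k, v, u. Qed.

Lemma germ_rel_trans p q r : germ_rel p q -> germ_rel q r -> germ_rel p r.
Proof.
move=> [k [u [v e]]] [k' [u' [v' e']]]; have [l [a [a' aa']]] := arr_ore v u'.
exists l, (arr_comp a u), (arr_comp a' v').
by rewrite !tr_comp e -e' -!tr_comp aa'.
Qed.

(** The quotient is realized as the set of equivalence classes, so equality of germs is extensional
    equality of predicates. *)
Definition germs := {A : set {i & X i} | exists p, A = germ_rel p}.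

Definition germ i (x : X i) : germs :=
  exist _ (germ_rel (Tagged X x)) (ex_intro _ _ erefl).

Lemma germP i j (x : X i) (y : X j) :
  germ x = germ y <-> germ_rel (Tagged X x) (Tagged X y).
Proof.
split=> [[e]|xy].
  rewrite e; exists j, (arr_id j), (arr_id j); exact: erefl.
apply: eq_exist; apply/funext => r; apply/propext; split.
  exact: germ_rel_trans (germ_rel_sym xy).
exact: germ_rel_trans xy.
Qed.

Definition germ_cone : colimit_cone X.
Proof.
exists germs germ.
- move=> i j u x; apply/germP.
  by exists j, (arr_id j), (arr_comp (arr_id j) u); rewrite /= tr_comp.
- move=> [A [[i x] Ax]]; exists i, x; exact: eq_exist.
- by move=> i j x y /germP.
Defined.

End Germs.

(* Partially defined operations extend along a colimit cone: [P] is their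
   domain of definition, and the value is computed on a representative lying
   in [P] whenever there is one. *)
Section Extension.
Variables (X : sys) (c : colimit_cone X) (Y : Type).
Variables (P : forall i, X i -> Prop) (op : forall i, X i -> Y).

Lemma ext_rep (q : pt c) : exists p : {i & X i},
  q = leg c (tagged p) /\
  ((exists i (x : X i), q = leg c x /\ P x) -> P (tagged p)).
Proof.
have [[i [x [qx Px]]]|nP] := EM (exists i (x : X i), q = leg c x /\ P x).
  by exists (Tagged X x).
by have [i [x qx]] := leg_surj q; exists (Tagged X x); split=> // /nP.
Qed.

(* Locked, because unification would otherwise see the value of [ext] as an
   instance of [op]. *)
Definition ext : pt c -> Y :=
  locked (fun q => op (tagged (sval (cid (ext_rep q))))).

Hypothesis op_tr : forall i j (u : arr i j) x, P x -> op (tr u x) = op x.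

(** Since [x] lies in [P], so does the chosen representative; hence [op_tr] carries both values to a
    stage where the two representatives agree. *)
Lemma extE i (x : X i) : P x -> ext (leg c x) = op x.
Proof.
move=> Px; rewrite /ext -lock; case: cid => -[j y] /= [e Py].
have {}Py : P y by apply: Py; exists i, x.
have [k [u [v uv]]] := leg_sep e.
by rewrite -(op_tr u Px) uv op_tr.
Qed.

End Extension.

End FilteredColimits.

(** * The colimit category *)

Section DiagramColimit.
Variables (I : category) (I_filt : filtered I) (D : diagram I).
Implicit Types i j k l : Ob I.

Definition dgf i j (u : arr i j) : ttfunctor (D i) (D j) :=
  dg_mor D (proj2_sig u).

Definition ob_sys : sys I.
Proof.
exists (fun i => Ob (D i)) (fun i j u => fob (dgf u)).
by move=> i j k v u x; exact: dg_comp_ob.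
Defined.

Definition mor_sys : sys I.
Proof.
exists (fun i => Mor (D i)) (fun i j u => fmor (dgf u)).
by move=> i j k v u x; exact: dg_comp_mor.
Defined.

Let cO := germ_cone I_filt ob_sys.
Let cM := germ_cone I_filt mor_sys.
Let gO i (a : Ob (D i)) : pt cO := leg cO (a : ob_sys i).
Let gM i (f : Mor (D i)) : pt cM := leg cM (f : mor_sys i).

Let gO_tr i j (u : arr i j) a : gO (fob (dgf u) a) = gO a.
Proof. exact: (leg_tr cO). Qed.

Let gM_tr i j (u : arr i j) f : gM (fmor (dgf u) f) = gM f.
Proof. exact: (leg_tr cM). Qed.

Definition lim_dom : pt cM -> pt cO :=
  ext (fun _ _ => True) (fun i (f : mor_sys i) => gO (dom f)).
Definition lim_cod : pt cM -> pt cO :=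
  ext (fun _ _ => True) (fun i (f : mor_sys i) => gO (cod f)).
Definition lim_idm : pt cO -> pt cM :=
  ext (fun _ _ => True) (fun i (a : ob_sys i) => gM (idm a)).
Definition lim_comp (g f : pt cM) : pt cM :=
  ext (c := prod_cone I_filt cM cM)
    (fun i (p : prod_sys mor_sys mor_sys i) => dom p.1 = cod p.2)
    (fun i (p : prod_sys mor_sys mor_sys i) => gM (p.1 ∘ p.2)) (g, f).

Lemma lim_domE i (f : Mor (D i)) : lim_dom (gM f) = gO (dom f).
Proof. by apply: extE => //= j k u g _; rewrite dom_fmor gO_tr. Qed.

Lemma lim_codE i (f : Mor (D i)) : lim_cod (gM f) = gO (cod f).
Proof. by apply: extE => //= j k u g _; rewrite cod_fmor gO_tr. Qed.

Lemma lim_idmE i (a : Ob (D i)) : lim_idm (gO a) = gM (idm a).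
Proof. by apply: extE => //= j k u b _; rewrite -fmor_idm gM_tr. Qed.

Lemma lim_compE i (g f : Mor (D i)) :
  dom g = cod f -> lim_comp (gM g) (gM f) = gM (g ∘ f).
Proof.
move=> gf; apply: (@extE _ _ (prod_cone I_filt cM cM) _ _ _ _ i (g, f)) => //=.
by move=> j k u [h e] /= he; rewrite -fmor_comp// gM_tr.
Qed.

Let liftM f : exists i (f0 : Mor (D i)), f = gM f0 := leg_surj f.

(** Composability of germs is an equation between germs of objects, so it holds for representatives
    at a later stage, where [lim_compE] applies. *)
Let liftMM f g : lim_dom g = lim_cod f ->
  exists i (g0 f0 : Mor (D i)), [/\ g = gM g0, f = gM f0 & dom g0 = cod f0].
Proof.
have [i [[g0 f0] [-> ->]]] := leg_surj (c := prod_cone I_filt cM cM) (g, f).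
rewrite lim_domE lim_codE => /(leg_eq I_filt)[j [u e]].
exists j, (fmor (dgf u) g0), (fmor (dgf u) f0).
by rewrite !gM_tr dom_fmor cod_fmor.
Qed.

Let liftMMM h g f : exists i (h0 g0 f0 : Mor (D i)),
  [/\ h = gM h0, g = gM g0 & f = gM f0].
Proof.
have [i [[[h0 g0] f0] [-> -> ->]]] :=
  leg_surj (c := prod_cone I_filt (prod_cone I_filt cM cM) cM) (h, g, f).
by exists i, h0, g0, f0.
Qed.

Definition lim_cat : category.
Proof.
exists (pt cO) (pt cM) lim_dom lim_cod lim_idm lim_comp.
- move=> a; have [i [a0 ->]] := leg_surj a.
  by rewrite lim_idmE lim_domE dom_idm.
- move=> a; have [i [a0 ->]] := leg_surj a.
  by rewrite lim_idmE lim_codE cod_idm.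
- move=> g f /liftMM[i [g0 [f0 [-> -> e]]]].
  by rewrite lim_compE// !lim_domE dom_comp.
- move=> g f /liftMM[i [g0 [f0 [-> -> e]]]].
  by rewrite lim_compE// !lim_codE cod_comp.
- move=> f; have [i [f0 ->]] := liftM f.
  by rewrite lim_codE lim_idmE lim_compE ?dom_idm// comp_idl.
- move=> f; have [i [f0 ->]] := liftM f.
  by rewrite lim_domE lim_idmE lim_compE ?cod_idm// comp_idr.
- move=> h g f.
  have [i [h0 [g0 [f0 [-> -> ->]]]]] := liftMMM h g f.
  rewrite !lim_domE !lim_codE => e1 e2.
  (* Both composability equations are packed into one equation of pairs, which yields a single stage
     for both. *)
  have [j [u [{}e1 {}e2]]] :=
    leg_eq I_filt (c := prod_cone I_filt cO cO) (i := i)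
      (x := (dom h0, dom g0)) (y := (cod g0, cod f0))
      (f_equal2 pair e1 e2).
  rewrite -(gM_tr u h0) -(gM_tr u g0) -(gM_tr u f0).
  rewrite -!dom_fmor -!cod_fmor in e1 e2.
  by rewrite !lim_compE ?dom_comp ?cod_comp// Defs.compA.
Defined.

(** The interface through which germs are used from here on. It only mentions the underlying
    category, so the same datum serves each time the category receives more structure. *)
Record cat_colimit (C : category) := CatColimit {
  lg :> forall i, functor (D i) C;
  lgO : forall i j (u : arr i j) a, fob (lg j) (fob (dgf u) a) = fob (lg i) a;
  lgM : forall i j (u : arr i j) f,
    fmor (lg j) (fmor (dgf u) f) = fmor (lg i) f;
  lg_surjO : forall a, exists i a0, a = fob (lg i) a0;
  lg_surjM : forall f, exists i f0, f = fmor (lg i) f0;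
  lg_eqO : forall i a b, fob (lg i) a = fob (lg i) b ->
    exists j (u : arr i j), fob (dgf u) a = fob (dgf u) b;
  lg_eqM : forall i f g, fmor (lg i) f = fmor (lg i) g ->
    exists j (u : arr i j), fmor (dgf u) f = fmor (dgf u) g }.

Definition lim_leg i : functor (D i) lim_cat.
Proof.
exists (fun a => gO a) (fun f => gM f) => /=.
- exact: lim_domE.
- exact: lim_codE.
- by move=> a; rewrite lim_idmE.
- by move=> g f e; rewrite lim_compE.
Defined.

Definition lim_cat_colimit : cat_colimit lim_cat.
Proof.
exists lim_leg => /=.
- exact: gO_tr.
- exact: gM_tr.
- exact: (@leg_surj _ _ cO).
- exact: (@leg_surj _ _ cM).
- by move=> i a b e; exact: (leg_eq I_filt (c := cO) e).
- by move=> i a b e; exact: (leg_eq I_filt (c := cM) e).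
Defined.

End DiagramColimit.

(** * Lifting data and statements from the colimit to a stage *)

Section Lifting.
Variables (I : category) (I_filt : filtered I) (D : diagram I).
Variables (C : category) (G : cat_colimit D C).
Implicit Types i j k l : Ob I.

Lemma dgfO i j k (v : arr j k) (u : arr i j) a :
  fob (dgf D (arr_comp v u)) a = fob (dgf D v) (fob (dgf D u) a).
Proof. exact: dg_comp_ob. Qed.

Lemma dgfM i j k (v : arr j k) (u : arr i j) f :
  fmor (dgf D (arr_comp v u)) f = fmor (dgf D v) (fmor (dgf D u) f).
Proof. exact: dg_comp_mor. Qed.

Lemma hom_fmorE (A B : category) (F : functor A B) a b f :
  hom a b f -> hom (fob F a) (fob F b) (fmor F f).
Proof. by move=> [<- <-]; split; [exact: dom_fmor | exact: cod_fmor]. Qed.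

Lemma idm_idm (A : category) (a : Ob A) : idm a ∘ idm a = idm a.
Proof. by rewrite -{1}(cod_idm a) comp_idl. Qed.

Lemma isom_fmorE (A B : category) (F : functor A B) a b f :
  isom a b f -> isom (fob F a) (fob F b) (fmor F f).
Proof.
move=> [hf [g [g1 g2 gf fg]]]; split; first exact: hom_fmorE.
exists (fmor F g); split; rewrite ?dom_fmor ?cod_fmor ?g1 ?g2//.
  by rewrite -fmor_comp// gf fmor_idm.
by rewrite -fmor_comp// fg fmor_idm.
Qed.

Definition ob_cone : colimit_cone (ob_sys D).
Proof.
exists (Ob C) (fun i => fob (G i)).
- by move=> i j u a; exact: lgO.
- exact: lg_surjO.
- move=> i j x y xy; have [k [u [v _]]] := arr_join I_filt i j.
  rewrite -(lgO G u) -(lgO G v) in xy; have [l [w e]] := lg_eqO xy.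
  by exists l, (arr_comp w u), (arr_comp w v); rewrite /= !dgfO.
Defined.

Definition mor_cone : colimit_cone (mor_sys D).
Proof.
exists (Mor C) (fun i => fmor (G i)).
- by move=> i j u a; exact: lgM.
- exact: lg_surjM.
- move=> i j x y xy; have [k [u [v _]]] := arr_join I_filt i j.
  rewrite -(lgM G u) -(lgM G v) in xy; have [l [w e]] := lg_eqM xy.
  by exists l, (arr_comp w u), (arr_comp w v); rewrite /= !dgfM.
Defined.

Local Notation "c ** d" := (prod_cone I_filt c d)
  (at level 40, left associativity).

Lemma liftO_above i a : exists j (u : arr i j) a0, a = fob (G j) a0.
Proof.
have [k [a0 ->]] := lg_surjO G a; have [j [u [v _]]] := arr_join I_filt i k.
by exists j, u, (fob (dgf D v) a0); rewrite lgO.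
Qed.

Lemma liftM_above i f : exists j (u : arr i j) f0, f = fmor (G j) f0.
Proof.
have [k [f0 ->]] := lg_surjM G f; have [j [u [v _]]] := arr_join I_filt i k.
by exists j, u, (fmor (dgf D v) f0); rewrite lgM.
Qed.

Lemma lift2O a b : exists i a0 b0, a = fob (G i) a0 /\ b = fob (G i) b0.
Proof.
have [i [[a0 b0] [-> ->]]] := leg_surj (c := ob_cone ** ob_cone) (a, b).
by exists i, a0, b0.
Qed.

Lemma lift3O a b c : exists i a0 b0 c0,
  [/\ a = fob (G i) a0, b = fob (G i) b0 & c = fob (G i) c0].
Proof.
have [i [[[a0 b0] c0] [-> -> ->]]] :=
  leg_surj (c := ob_cone ** ob_cone ** ob_cone) (a, b, c).
by exists i, a0, b0, c0.
Qed.

Lemma lift4O a b c d : exists i a0 b0 c0 d0,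
  [/\ a = fob (G i) a0, b = fob (G i) b0, c = fob (G i) c0
    & d = fob (G i) d0].
Proof.
have [i [[[[a0 b0] c0] d0] [-> -> -> ->]]] :=
  leg_surj (c := ob_cone ** ob_cone ** ob_cone ** ob_cone) (a, b, c, d).
by exists i, a0, b0, c0, d0.
Qed.

Lemma lift2M f g : exists i f0 g0, f = fmor (G i) f0 /\ g = fmor (G i) g0.
Proof.
have [i [[a0 b0] [-> ->]]] := leg_surj (c := mor_cone ** mor_cone) (f, g).
by exists i, a0, b0.
Qed.

Lemma lift3M f g h : exists i f0 g0 h0,
  [/\ f = fmor (G i) f0, g = fmor (G i) g0 & h = fmor (G i) h0].
Proof.
have [i [[[a0 b0] c0] [-> -> ->]]] :=
  leg_surj (c := mor_cone ** mor_cone ** mor_cone) (f, g, h).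
by exists i, a0, b0, c0.
Qed.

Lemma lift4M f g h h' : exists i f0 g0 h0 h0',
  [/\ f = fmor (G i) f0, g = fmor (G i) g0, h = fmor (G i) h0
    & h' = fmor (G i) h0'].
Proof.
have [i [[[[a0 b0] c0] d0] [-> -> -> ->]]] :=
  leg_surj (c := mor_cone ** mor_cone ** mor_cone ** mor_cone) (f, g, h, h').
by exists i, a0, b0, c0, d0.
Qed.

(* [Q] is a statement about the images in [C] of data living at stage [i], and
   [P j u] the same statement about their images at stage [j]. *)
Definition lifts i (Q : Prop) (P : forall j, arr i j -> Prop) : Prop :=
  (Q -> exists j u, P j u) /\
  (forall j (u : arr i j) k (v : arr j k), P j u -> P k (arr_comp v u)).

(** The two conditions are first reached at different stages; their stability under later arrows
    brings them to the corner of an Ore square. *)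
Lemma lifts_and i Q Q' P P' : lifts (i := i) Q P -> lifts Q' P' ->
  lifts (Q /\ Q') (fun j u => P j u /\ P' j u).
Proof.
move=> [QP sP] [QP' sP']; split.
  move=> [/QP[j [u Pu]] /QP'[j' [u' Pu']]].
  have [k [v [v' e]]] := arr_ore I_filt u u'.
  by exists k, (arr_comp v u); split; [exact: sP | rewrite e; exact: sP'].
by move=> j u k v [Pu Pu']; split; [exact: sP | exact: sP'].
Qed.

Lemma lifts_and3 i Q1 Q2 Q3 P1 P2 P3 :
  lifts (i := i) Q1 P1 -> lifts Q2 P2 -> lifts Q3 P3 ->
  lifts [/\ Q1, Q2 & Q3] (fun j u => [/\ P1 j u, P2 j u & P3 j u]).
Proof.
move=> l1 l2 l3; have [h s] := lifts_and l1 (lifts_and l2 l3); split.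
  by move=> [q1 q2 q3]; have [|j [u [? [? ?]]]] := h => //; exists j, u.
by move=> j u k v [p1 p2 p3]; have [? []] := s j u k v (conj p1 (conj p2 p3)).
Qed.

Lemma lifts_eqO i (a b : Ob (D i)) :
  lifts (fob (G i) a = fob (G i) b)
    (fun j u => fob (dgf D u) a = fob (dgf D u) b).
Proof. by split=> [/lg_eqO//|j u k v]; rewrite !dgfO => ->. Qed.

Lemma lifts_eqM i (f g : Mor (D i)) :
  lifts (fmor (G i) f = fmor (G i) g)
    (fun j u => fmor (dgf D u) f = fmor (dgf D u) g).
Proof. by split=> [/lg_eqM//|j u k v]; rewrite !dgfM => ->. Qed.

Lemma lifts_dom_ob i (f : Mor (D i)) a :
  lifts (dom (fmor (G i) f) = fob (G i) a)
    (fun j u => dom (fmor (dgf D u) f) = fob (dgf D u) a).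
Proof.
have [h s] := lifts_eqO (dom f) a; rewrite dom_fmor; split.
  by move=> /h[j [u e]]; exists j, u; rewrite dom_fmor.
by move=> j u k v; rewrite !dom_fmor; exact: s.
Qed.

Lemma lifts_cod_ob i (f : Mor (D i)) a :
  lifts (cod (fmor (G i) f) = fob (G i) a)
    (fun j u => cod (fmor (dgf D u) f) = fob (dgf D u) a).
Proof.
have [h s] := lifts_eqO (cod f) a; rewrite cod_fmor; split.
  by move=> /h[j [u e]]; exists j, u; rewrite cod_fmor.
by move=> j u k v; rewrite !cod_fmor; exact: s.
Qed.

Lemma lifts_hom i a b (f : Mor (D i)) :
  lifts (hom (fob (G i) a) (fob (G i) b) (fmor (G i) f))
    (fun j u => hom (fob (dgf D u) a) (fob (dgf D u) b) (fmor (dgf D u) f)).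
Proof. exact: lifts_and (lifts_dom_ob f a) (lifts_cod_ob f b). Qed.

Lemma lifts_dom_cod i (g f : Mor (D i)) :
  lifts (dom (fmor (G i) g) = cod (fmor (G i) f))
    (fun j u => dom (fmor (dgf D u) g) = cod (fmor (dgf D u) f)).
Proof.
have [h s] := lifts_dom_ob g (cod f); rewrite (cod_fmor (G i) f); split.
  by move=> /h[j [u e]]; exists j, u; rewrite cod_fmor.
by move=> j u k v; rewrite !cod_fmor; exact: s.
Qed.

Lemma lifts_dom_dom i (g f : Mor (D i)) :
  lifts (dom (fmor (G i) g) = dom (fmor (G i) f))
    (fun j u => dom (fmor (dgf D u) g) = dom (fmor (dgf D u) f)).
Proof.
have [h s] := lifts_dom_ob g (dom f); rewrite (dom_fmor (G i) f); split.
  by move=> /h[j [u e]]; exists j, u; rewrite (dom_fmor _ f).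
by move=> j u k v; rewrite !(dom_fmor _ f); exact: s.
Qed.

Lemma lifts_cod_cod i (g f : Mor (D i)) :
  lifts (cod (fmor (G i) g) = cod (fmor (G i) f))
    (fun j u => cod (fmor (dgf D u) g) = cod (fmor (dgf D u) f)).
Proof.
have [h s] := lifts_cod_ob g (cod f); rewrite (cod_fmor (G i) f); split.
  by move=> /h[j [u e]]; exists j, u; rewrite (cod_fmor _ f).
by move=> j u k v; rewrite !(cod_fmor _ f); exact: s.
Qed.

Lemma lifts_parallel i (f g : Mor (D i)) :
  lifts (parallel (fmor (G i) f) (fmor (G i) g))
    (fun j u => parallel (fmor (dgf D u) f) (fmor (dgf D u) g)).
Proof. exact: lifts_and (lifts_dom_dom f g) (lifts_cod_cod f g). Qed.

(** Composability is part of the statement because functors commute with [∘] on composable pairs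
    only: it is lifted first, and the equation of composites at a further stage. *)
Lemma lifts_square i (g f g' f' : Mor (D i)) :
  lifts [/\ dom (fmor (G i) g) = cod (fmor (G i) f),
            dom (fmor (G i) g') = cod (fmor (G i) f')
          & fmor (G i) g ∘ fmor (G i) f = fmor (G i) g' ∘ fmor (G i) f']
    (fun j u => [/\ dom (fmor (dgf D u) g) = cod (fmor (dgf D u) f),
            dom (fmor (dgf D u) g') = cod (fmor (dgf D u) f')
          & fmor (dgf D u) g ∘ fmor (dgf D u) f
            = fmor (dgf D u) g' ∘ fmor (dgf D u) f']).
Proof.
split.
  move=> [d d' e]; have [j [u [{}d {}d']]] :=
    (lifts_and (lifts_dom_cod g f) (lifts_dom_cod g' f')).1 (conj d d').
  rewrite -!(lgM G u) -!(fmor_comp (G j))// in e.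
  have [k [v e']] := lg_eqM e; rewrite !(fmor_comp (dgf D v))// in e'.
  exists k, (arr_comp v u); rewrite !dgfM e'.
  by split=> //; rewrite !(dom_fmor (dgf D v)) !(cod_fmor (dgf D v)) ?d ?d'.
move=> j u k v [d d' e]; rewrite !dgfM -!(fmor_comp (dgf D v))// e.
by split=> //; rewrite !(dom_fmor (dgf D v)) !(cod_fmor (dgf D v)) ?d ?d'.
Qed.

Lemma lifts_inverse i (f g : Mor (D i)) :
  lifts (inverse (fmor (G i) f) (fmor (G i) g))
    (fun j u => inverse (fmor (dgf D u) f) (fmor (dgf D u) g)).
Proof.
split.
  move=> [d c gf fg].
  (* Writing an identity as [idm ∘ idm] turns each of the two inverse laws into a square. *)
  have l1 := lifts_square g f (idm (dom f)) (idm (dom f)).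
  have l2 := lifts_square f g (idm (cod f)) (idm (cod f)).
  have [|j [u [[e1 _ e2] [e3 _ e4]]]] := (lifts_and l1 l2).1.
    rewrite !fmor_idm !idm_idm !dom_idm !cod_idm -dom_fmor -cod_fmor.
    by rewrite gf fg d c.
  rewrite !fmor_idm !idm_idm -dom_fmor -cod_fmor in e2 e4.
  by exists j, u; split.
move=> j u k v [d c gf fg]; rewrite !dgfM.
split.
- by rewrite (dom_fmor (dgf D v)) (cod_fmor (dgf D v)) d.
- by rewrite (cod_fmor (dgf D v)) (dom_fmor (dgf D v)) c.
- by rewrite -(fmor_comp (dgf D v))// gf fmor_idm (dom_fmor (dgf D v)).
- by rewrite -(fmor_comp (dgf D v))// fg fmor_idm (cod_fmor (dgf D v)).
Qed.

Lemma lifts_isom i a b (f : Mor (D i)) :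
  lifts (isom (fob (G i) a) (fob (G i) b) (fmor (G i) f))
    (fun j u => isom (fob (dgf D u) a) (fob (dgf D u) b) (fmor (dgf D u) f)).
Proof.
split.
  (* The inverse in [C] is represented only at some later stage [j], and its laws are lifted from
     there. *)
  move=> [hf [g fg]]; have [j [u [g0 eg]]] := liftM_above i g.
  rewrite eg in fg.
  rewrite -(lgM G u) -!(lgO G u) in hf fg.
  have [k [v [{}hf {}fg]]] := (lifts_and (lifts_hom _ _ _)
    (lifts_inverse _ _)).1 (conj hf fg).
  exists k, (arr_comp v u); rewrite !dgfM !dgfO; split=> //.
  by exists (fmor (dgf D v) g0).
by move=> j u k v; rewrite !dgfM !dgfO; exact: isom_fmorE.
Qed.

End Lifting.

(** * The additive structure *)

Section AdditiveFunctors.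
Variables (A B : preaddcat) (F : functor A B).
Hypothesis F_add : additive_functor F.

(** Additive functors are only assumed to preserve sums; zeros follow because a morphism equal to
    its own double is zero. This makes the zero morphisms of the colimit well defined. *)
Lemma addf_zerom a b : fmor F (zerom a b) = zerom (fob F a) (fob F b).
Proof.
have hz := hom_zerom a b; apply: hom_add_idem; first exact: hom_fmorE.
by rewrite -F_add ?(hom_add0 hz).
Qed.

Lemma oppm_unique (C : preaddcat) (a b : Ob C) f g : hom a b f -> hom a b g ->
  addm g f = zerom a b -> g = oppm f.
Proof.
move=> hf hg gf; have hN := hom_opp hf.
rewrite -(hom_zero_idem hg) -(hom_addN hf) (hom_addC hN hf).
rewrite addmA ?gf ?(hom_add0 hN)//.
  exact: hom_parallel hg hf.
exact: hom_parallel hf hN.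
Qed.

Lemma addf_oppm f : fmor F (oppm f) = oppm (fmor F f).
Proof.
have hf : hom (dom f) (cod f) f by [].
apply: (oppm_unique (hom_fmorE F hf)); first exact: (hom_fmorE F (hom_opp hf)).
rewrite -F_add ?(hom_addN hf) ?addf_zerom//.
exact: (hom_parallel (hom_opp hf) hf).
Qed.

Lemma addf_zero_object z : zero_object z -> zero_object (fob F z).
Proof. by move=> z0; rewrite /zero_object /= -fmor_idm z0 addf_zerom. Qed.

Lemma addf_biproduct_maps a b s i1 i2 p1 p2 :
  biproduct_maps a b s i1 i2 p1 p2 ->
  biproduct_maps (fob F a) (fob F b) (fob F s)
    (fmor F i1) (fmor F i2) (fmor F p1) (fmor F p2).
Proof.
move=> [hi1 hi2 hp1 hp2 e11 e22 e12 e21 ip].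
split; try exact: hom_fmorE.
- by rewrite -fmor_comp ?e11 ?fmor_idm// hp1.1 hi1.2.
- by rewrite -fmor_comp ?e22 ?fmor_idm// hp2.1 hi2.2.
- by rewrite -fmor_comp ?e12 ?addf_zerom// hp1.1 hi2.2.
- by rewrite -fmor_comp ?e21 ?addf_zerom// hp2.1 hi1.2.
- rewrite -!fmor_comp ?hi1.1 ?hp1.2 ?hi2.1 ?hp2.2// -F_add.
    by rewrite ip fmor_idm.
  exact: (hom_parallel (hom_comp hi1 hp1) (hom_comp hi2 hp2)).
Qed.

End AdditiveFunctors.

Section PreadditiveColimit.
Variables (I : category) (I_filt : filtered I) (D : diagram I).
Variables (C : category) (G : cat_colimit D C).
Implicit Types i j k l : Ob I.

Local Notation "c ** d" := (prod_cone I_filt c d)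
  (at level 40, left associativity).

Definition lim_zerom (a b : Ob C) : Mor C :=
  ext (c := ob_cone I_filt G ** ob_cone I_filt G) (fun _ _ => True)
    (fun i (p : prod_sys (ob_sys D) (ob_sys D) i) =>
       fmor (G i) (zerom p.1 p.2)) (a, b).

Definition lim_addm (f g : Mor C) : Mor C :=
  ext (c := mor_cone I_filt G ** mor_cone I_filt G)
    (fun i (p : prod_sys (mor_sys D) (mor_sys D) i) => parallel p.1 p.2)
    (fun i (p : prod_sys (mor_sys D) (mor_sys D) i) =>
       fmor (G i) (addm p.1 p.2)) (f, g).

Definition lim_oppm (f : Mor C) : Mor C :=
  ext (c := mor_cone I_filt G) (fun _ _ => True)
    (fun i (f : mor_sys D i) => fmor (G i) (oppm f)) f.

Lemma lim_zeromE i (a b : Ob (D i)) :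
  lim_zerom (fob (G i) a) (fob (G i) b) = fmor (G i) (zerom a b).
Proof.
apply: (@extE _ _ (ob_cone I_filt G ** ob_cone I_filt G)
  _ _ _ _ i (a, b)) => //= j k u [c d] /= _.
by rewrite -(addf_zerom (tf_add _)) lgM.
Qed.

Lemma lim_addmE i (f g : Mor (D i)) : parallel f g ->
  lim_addm (fmor (G i) f) (fmor (G i) g) = fmor (G i) (addm f g).
Proof.
move=> fg; apply: (@extE _ _ (mor_cone I_filt G ** mor_cone I_filt G)
  _ _ _ _ i (f, g)) => //= j k u [c d] /= cd.
by rewrite -(tf_add (dgf D u))// lgM.
Qed.

Lemma lim_oppmE i (f : Mor (D i)) :
  lim_oppm (fmor (G i) f) = fmor (G i) (oppm f).
Proof.
apply: (@extE _ _ (mor_cone I_filt G) _ _ _ _ i f) => //= j k u c /= _.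
by rewrite -(addf_oppm (tf_add (dgf D u))) lgM.
Qed.

Lemma lift2M_parallel (f g : Mor C) : parallel f g -> exists i f0 g0,
  [/\ f = fmor (G i) f0, g = fmor (G i) g0 & parallel f0 g0].
Proof.
have [i [f0 [g0 [-> ->]]]] := lift2M I_filt G f g.
move=> /(lifts_parallel I_filt G _ _).1[j [u p]].
by exists j, (fmor (dgf D u) f0), (fmor (dgf D u) g0); rewrite !lgM.
Qed.

Definition lim_preadd : preaddcat.
Proof.
exists C lim_zerom lim_addm lim_oppm.
- move=> a b; have [i [a0 [b0 [-> ->]]]] := lift2O I_filt G a b.
  by rewrite lim_zeromE; apply: hom_fmorE; exact: hom_zerom.
- move=> f g /lift2M_parallel[i [f0 [g0 [-> -> p]]]].
  by rewrite lim_addmE// dom_fmor cod_fmor; apply: hom_fmorE; exact: hom_addm.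
- move=> f; have [i [f0 ->]] := lg_surjM G f.
  by rewrite lim_oppmE dom_fmor cod_fmor; apply: hom_fmorE; exact: hom_oppm.
- move=> f g h; have [i [f0 [g0 [h0 [-> -> ->]]]]] := lift3M I_filt G f g h.
  move=> p q; have [j [u [{}p {}q]]] := (lifts_and I_filt
    (lifts_parallel I_filt G _ _) (lifts_parallel I_filt G _ _)).1 (conj p q).
  (* The images at stage [j] replace the representatives: there they are parallel, and the axiom of
     [D j] applies. *)
  rewrite -!(lgM G u); move: p q; move: (fmor _ f0) (fmor _ g0) (fmor _ h0).
  move=> {g h f0 g0 h0}{}f g h p q.
  have fgh : parallel f (addm g h).
    have [e1 e2] := hom_addm q; case: p => p1 p2.
    by split; rewrite ?e1 ?e2.
  have fgh' : parallel (addm f g) h.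
    have [e1 e2] := hom_addm p; case: p q => p1 p2 [q1 q2].
    by split; rewrite ?e1 ?e2 ?p1 ?p2.
  by rewrite !lim_addmE// addmA.
- move=> f g /lift2M_parallel[i [f0 [g0 [-> -> p]]]].
  have p' : parallel g0 f0 by case: p => p1 p2; split.
  by rewrite !lim_addmE// addmC.
- move=> f; have [i [f0 ->]] := lg_surjM G f.
  rewrite dom_fmor cod_fmor lim_zeromE lim_addmE ?add0m//.
  by have [] := hom_zerom (dom f0) (cod f0).
- move=> f; have [i [f0 ->]] := lg_surjM G f.
  rewrite lim_oppmE dom_fmor cod_fmor lim_zeromE lim_addmE ?addNm//.
  exact: hom_oppm.
- move=> g g' f.
  have [i [g0 [g'0 [f0 [-> -> ->]]]]] := lift3M I_filt G g g' f.
  move=> p q; have [j [u [{}p {}q]]] := (lifts_and I_filt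
    (lifts_parallel I_filt G _ _) (lifts_dom_cod G _ _)).1 (conj p q).
  rewrite -!(lgM G u); move: p q.
  move: (fmor _ f0) (fmor _ g0) (fmor _ g'0) => {g g' f0 g0 g'0}{}f g g' p q.
  have q' : dom g' = cod f by case: p => <-.
  have p' : parallel (g ∘ f) (g' ∘ f).
    by case: p => p1 p2; split; rewrite ?dom_comp ?cod_comp.
  rewrite lim_addmE// -!(fmor_comp (G j)) ?lim_addmE ?comp_addl//.
  by have [-> _] := hom_addm p.
- move=> g f f'.
  have [i [g0 [f0 [f'0 [-> -> ->]]]]] := lift3M I_filt G g f f'.
  move=> p q; have [j [u [{}p {}q]]] := (lifts_and I_filt
    (lifts_parallel I_filt G _ _) (lifts_dom_cod G _ _)).1 (conj p q).
  rewrite -!(lgM G u); move: p q.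
  move: (fmor _ f0) (fmor _ g0) (fmor _ f'0) => {g f' f0 g0 f'0}{}f g f' p q.
  have q' : dom g = cod f' by case: p => _ <-.
  have p' : parallel (g ∘ f) (g ∘ f').
    by case: p => p1 p2; split; rewrite ?dom_comp ?cod_comp.
  rewrite lim_addmE// -!(fmor_comp (G j)) ?lim_addmE ?comp_addr//.
  by have [_ ->] := hom_addm p.
Defined.

Lemma lim_preadd_leg i :
  additive_functor (D := lim_preadd) (G i : functor (D i) C).
Proof. by move=> f g p; rewrite -lim_addmE. Qed.

End PreadditiveColimit.

Section AdditiveColimit.
Variables (I : category) (I_filt : filtered I) (D : diagram I).
Variables (C : preaddcat) (G : cat_colimit D C).
Hypothesis G_add : forall i, additive_functor (G i).
Implicit Types i j k l : Ob I.

Definition lim_add : addcat.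
Proof.
exists C.
- have [i _] := filt_inhabited I_filt; have [z z0] := ac_zero (D i).
  by exists (fob (G i) z); exact: addf_zero_object.
- move=> a b; have [i [a0 [b0 [-> ->]]]] := lift2O I_filt G a b.
  have [s [i1 [i2 [p1 [p2 B]]]]] := ac_biproduct a0 b0.
  exists (fob (G i) s), (fmor (G i) i1), (fmor (G i) i2).
  exists (fmor (G i) p1), (fmor (G i) p2); exact: addf_biproduct_maps.
Defined.

(** Being a zero object is an equation between two morphisms, so it is reached at a stage. *)
Lemma lifts_zero_object i (z : Ob (D i)) :
  lifts (zero_object (fob (G i) z))
    (fun j u => zero_object (fob (dgf D u) z)).
Proof.
rewrite /zero_object/=; split=> [|j u k v].
  rewrite -fmor_idm -(addf_zerom (@G_add i)) => /lg_eqM[j [u]].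
  by rewrite fmor_idm (addf_zerom (tf_add _)); exists j, u.
by move=> e; rewrite dgfO -fmor_idm e (addf_zerom (tf_add _)).
Qed.

End AdditiveColimit.

(** * Triangles *)

Lemma parallel_fmor (A B : category) (F : functor A B) f g :
  parallel f g -> parallel (fmor F f) (fmor F g).
Proof. by move=> [e1 e2]; split; rewrite ?dom_fmor ?cod_fmor ?e1 ?e2. Qed.

Lemma tf_triangle (S T : ttcat) (F : ttfunctor S T) u v w :
  triangle susp u v w -> triangle susp (fmor F u) (fmor F v) (fmor F w).
Proof.
move=> [e1 e2 e3].
by split; rewrite !(dom_fmor, cod_fmor) ?e1 ?e2 ?e3 ?tf_susp.
Qed.

Section TriangulatedColimit.
Variables (I : category) (I_filt : filtered I) (D : diagram I).
Variables (C : addcat) (G : cat_colimit D C).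
Hypothesis G_add : forall i, additive_functor (G i).
Implicit Types i j k l : Ob I.

(** Lists replace iterated products in the axioms of triangulated categories, which involve up to
    nine morphisms at once. *)
Lemma liftMs (s : seq (Mor C)) :
  exists i s0, s = [seq fmor (G i) f | f <- s0].
Proof.
elim: s => [|f s [i [s0 ->]]].
  by have [i _] := filt_inhabited I_filt; exists i, [::].
have [j [u [f0 ->]]] := liftM_above I_filt G i f.
exists j, (f0 :: [seq fmor (dgf D u) g | g <- s0]) => /=; congr cons.
by rewrite -map_comp; apply: eq_map => g /=; rewrite lgM.
Qed.

Definition lim_susp_ob : Ob C -> Ob C :=
  ext (c := ob_cone I_filt G) (fun _ _ => True)
    (fun i (a : ob_sys D i) => fob (G i) (fob susp a)).

Definition lim_susp_mor : Mor C -> Mor C :=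
  ext (c := mor_cone I_filt G) (fun _ _ => True)
    (fun i (f : mor_sys D i) => fmor (G i) (fmor susp f)).

Lemma lim_susp_obE i (a : Ob (D i)) :
  lim_susp_ob (fob (G i) a) = fob (G i) (fob susp a).
Proof.
apply: (@extE _ _ (ob_cone I_filt G) _ _ _ _ i a) => //= j k u b _.
by rewrite -(tf_susp (dgf D u)) lgO.
Qed.

Lemma lim_susp_morE i (f : Mor (D i)) :
  lim_susp_mor (fmor (G i) f) = fmor (G i) (fmor susp f).
Proof.
apply: (@extE _ _ (mor_cone I_filt G) _ _ _ _ i f) => //= j k u b _.
by rewrite -(tf_suspm (dgf D u)) lgM.
Qed.

Definition lim_susp : functor C C.
Proof.
exists lim_susp_ob lim_susp_mor.
- move=> f; have [i [f0 ->]] := lg_surjM G f.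
  by rewrite lim_susp_morE !dom_fmor lim_susp_obE.
- move=> f; have [i [f0 ->]] := lg_surjM G f.
  by rewrite lim_susp_morE !cod_fmor lim_susp_obE.
- move=> a; have [i [a0 ->]] := lg_surjO G a.
  by rewrite lim_susp_obE -!fmor_idm lim_susp_morE fmor_idm.
- move=> g f; have [i [g0 [f0 [-> ->]]]] := lift2M I_filt G g f.
  move=> /(lifts_dom_cod G _ _).1[j [u e]]; rewrite -!(lgM G u).
  rewrite -(fmor_comp (G j))// !lim_susp_morE (fmor_comp susp)//.
  by rewrite (fmor_comp (G j))// dom_fmor (cod_fmor susp) e.
Defined.

Lemma lim_suspO i (a : Ob (D i)) :
  fob lim_susp (fob (G i) a) = fob (G i) (fob susp a).
Proof. exact: lim_susp_obE. Qed.

Lemma lim_suspM i (f : Mor (D i)) :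
  fmor lim_susp (fmor (G i) f) = fmor (G i) (fmor susp f).
Proof. exact: lim_susp_morE. Qed.

(** The smallest class for which all legs are exact, hence one that any functor induced by a cocone
    preserves. *)
Definition lim_dist (u v w : Mor C) : Prop :=
  exists i (u0 v0 w0 : Mor (D i)),
    [/\ u = fmor (G i) u0, v = fmor (G i) v0, w = fmor (G i) w0
      & dist u0 v0 w0].

Lemma lim_dist_leg i (u v w : Mor (D i)) :
  dist u v w -> lim_dist (fmor (G i) u) (fmor (G i) v) (fmor (G i) w).
Proof. by exists i, u, v, w. Qed.

(** The distinguished representative lives at an unrelated stage [k]. Separation of triples gives a
    stage above [i] and [k] where it coincides with the given one, and transition functors are
    exact. *)
Lemma lifts_dist i (u v w : Mor (D i)) :
  lifts (lim_dist (fmor (G i) u) (fmor (G i) v) (fmor (G i) w))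
    (fun j e => dist (fmor (dgf D e) u) (fmor (dgf D e) v) (fmor (dgf D e) w)).
Proof.
split=> [[k [u0 [v0 [w0 [eu ev ew d]]]]]|j e k e'].
  have [l [a [b []]]] := leg_sep (c := prod_cone I_filt
    (prod_cone I_filt (mor_cone I_filt G) (mor_cone I_filt G))
    (mor_cone I_filt G)) (x := (u, v, w)) (y := (u0, v0, w0))
    (f_equal2 pair (f_equal2 pair eu ev) ew).
  by move=> /= ea eb ec; exists l, a; rewrite ea eb ec; exact: tf_dist.
by rewrite !dgfM; exact: tf_dist.
Qed.

Lemma lifts_triangle i (u v w : Mor (D i)) :
  lifts (triangle lim_susp (fmor (G i) u) (fmor (G i) v) (fmor (G i) w))
    (fun j e => triangle susp
       (fmor (dgf D e) u) (fmor (dgf D e) v) (fmor (dgf D e) w)).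
Proof.
have [h s] := lifts_and3 I_filt (lifts_dom_cod G v u) (lifts_dom_cod G w v)
  (lifts_cod_ob G w (fob susp (dom u))).
split=> [[e1 e2]|j e k e' [e1 e2]].
  rewrite dom_fmor lim_suspO => e3.
  have [//|j [e [d1 d2 d3]]] := h; exists j, e; split=> //.
  by rewrite d3 dom_fmor tf_susp.
rewrite dom_fmor -tf_susp => e3.
have [|d1 d2 d3] := s j e k e'; first by split.
by split=> //; rewrite d3 dom_fmor tf_susp.
Qed.

(** The squares in [triangle_iso] do not record composability; it is recovered from the shape of the
    source triangle and the endpoints of [f], [g], [h], so that [lifts_square] applies. *)
Lemma lift_triangle_iso i (u v w u' v' w' f g h : Mor (D i)) :
  triangle lim_susp (fmor (G i) u) (fmor (G i) v) (fmor (G i) w) ->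
  triangle lim_susp (fmor (G i) u') (fmor (G i) v') (fmor (G i) w') ->
  triangle_iso lim_susp
    (fmor (G i) u) (fmor (G i) v) (fmor (G i) w)
    (fmor (G i) u') (fmor (G i) v') (fmor (G i) w')
    (fmor (G i) f) (fmor (G i) g) (fmor (G i) h) ->
  exists j (e : arr i j), triangle_iso susp
    (fmor (dgf D e) u) (fmor (dgf D e) v) (fmor (dgf D e) w)
    (fmor (dgf D e) u') (fmor (dgf D e) v') (fmor (dgf D e) w')
    (fmor (dgf D e) f) (fmor (dgf D e) g) (fmor (dgf D e) h).
Proof.
move=> [t1 t2 t3] [t1' t2' t3'] [hf hg hh fg gh hf'].
have lf := lifts_isom I_filt G (dom u) (dom u') f.
have lg := lifts_isom I_filt G (dom v) (dom v') g.
have lh := lifts_isom I_filt G (dom w) (dom w') h.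
have l1 := lifts_square I_filt G g u u' f.
have l2 := lifts_square I_filt G h v v' g.
have l3 := lifts_square I_filt G (fmor susp f) w w' h.
have [|j [e [[a1 a2 a3] [[_ _ b1] [_ _ b2] [_ _ b3]]]]] := (lifts_and I_filt
  (lifts_and3 I_filt lf lg lh) (lifts_and3 I_filt l1 l2 l3)).1.
  rewrite !(dom_fmor (G i)) in hf hg hh; split; split=> //; split=> //.
  - by rewrite hg.1.1 -(dom_fmor (G i)) t1.
  - by rewrite hf.1.2 -(dom_fmor (G i)).
  - by rewrite hh.1.1 -(dom_fmor (G i)) t2.
  - by rewrite hg.1.2 -(dom_fmor (G i)).
  - by rewrite -lim_suspM t3 dom_fmor hf.1.1 (dom_fmor (G i)).
  - by rewrite hh.1.2 -(dom_fmor (G i)).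
  - by rewrite -lim_suspM.
by exists j, e; split; rewrite ?(dom_fmor (dgf D e)) -?tf_suspm.
Qed.

Lemma lim_triangle_leg i (u v w : Mor (D i)) : triangle susp u v w ->
  triangle lim_susp (fmor (G i) u) (fmor (G i) v) (fmor (G i) w).
Proof.
move=> [e1 e2 e3].
by split; rewrite !(dom_fmor, cod_fmor) ?e1 ?e2 ?e3 ?lim_suspO.
Qed.

Lemma lim_triangle u v w : lim_dist u v w -> triangle lim_susp u v w.
Proof.
move=> [i [u0 [v0 [w0 [-> -> -> d]]]]].
exact: lim_triangle_leg (tr_triangle (tc_axioms (D i)) d).
Qed.

Lemma lim_susp_equivalence : equivalence lim_susp.
Proof.
split=> [a b h|b]; last first.
  have [i [b0 ->]] := lg_surjO G b.
  have [a [f fi]] := (tr_susp_equiv (tc_axioms (D i))).2 b0.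
  exists (fob (G i) a), (fmor (G i) f); rewrite lim_suspO; exact: isom_fmorE.
have [i [a0 [b0 [-> ->]]]] := lift2O I_filt G a b.
have [j [u [h0 ->]]] := liftM_above I_filt G i h.
rewrite -!(lgO G u) !lim_suspO; move: (fob _ a0) (fob _ b0).
move=> {b h a0 b0}{}a b; move: h0 => h /(lifts_hom I_filt G _ _ _).1[k [v]].
rewrite !tf_susp => hh.
have [f [[hf Sf] uf]] := (tr_susp_equiv (tc_axioms (D k))).1 _ _ _ hh.
exists (fmor (G k) f); split.
  rewrite -!(lgO G v) lim_suspM Sf lgM; split=> //; exact: hom_fmorE.
(* A competitor [f'] is represented only at a later stage, and its properties hold later still, at
   [m]. Full faithfulness of the translation is used again there, with the image of [h]. *)
move=> f' [hf' Sf']; have [l [w [f1 ef']]] := liftM_above I_filt G k f'.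
rewrite {}ef' in hf' Sf' *.
rewrite -!(lgO G v) -!(lgO G w) in hf'.
rewrite lim_suspM -(lgM G v) -(lgM G w) in Sf'.
have [m [x [hf1 Sf1]]] := (lifts_and I_filt
  (lifts_hom I_filt G _ _ _) (lifts_eqM G _ _)).1 (conj hf' Sf').
have hx := hom_fmorE (dgf D x) (hom_fmorE (dgf D w) hh).
rewrite !tf_susp in hx; rewrite tf_suspm in Sf1.
have [f2 [_ uf2]] := (tr_susp_equiv (tc_axioms (D m))).1 _ _ _ hx.
rewrite -(lgM G w) -(lgM G x) -[RHS](lgM G x).
rewrite -(uf2 (fmor (dgf D x) f1))//.
rewrite -(uf2 (fmor (dgf D x) (fmor (dgf D w) f)))//; split.
  by apply: hom_fmorE; exact: hom_fmorE.
by rewrite -!tf_suspm Sf.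
Qed.

Lemma lim_tr_iso u v w u' v' w' f g h :
  lim_dist u v w -> triangle lim_susp u' v' w' ->
  triangle_iso lim_susp u v w u' v' w' f g h -> lim_dist u' v' w'.
Proof.
have [i [s es]] := liftMs [:: u; v; w; u'; v'; w'; f; g; h].
case: s es => [|u0 [|v0 [|w0 [|u1 [|v1 [|w1 [|f0 [|g0 [|h0 [|]]]]]]]]]] //.
move=> [-> -> -> -> -> -> -> -> ->] d t' ti.
have [j [e [{}d {t'}t1]]] := (lifts_and I_filt (lifts_dist _ _ _)
  (lifts_triangle u1 v1 w1)).1 (conj d t').
rewrite -!(lgM G e) in ti *.
have [k [e' ti']] := lift_triangle_iso
  (lim_triangle (lim_dist_leg d)) (lim_triangle_leg t1) ti.
rewrite -!(lgM G e'); apply: lim_dist_leg.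
apply: (tr_iso (tc_axioms (D k))) ti'; first exact: tf_dist.
exact: tf_triangle.
Qed.

Lemma lim_tr_rot u v w : triangle lim_susp u v w ->
  lim_dist u v w <-> lim_dist v w (oppm (fmor lim_susp u)).
Proof.
have [i [u0 [v0 [w0 [-> -> ->]]]]] := lift3M I_filt G u v w.
move=> /(lifts_triangle _ _ _).1[j [e t]].
rewrite -!(lgM G e) lim_suspM -(addf_oppm (@G_add j)).
split=> /(lifts_dist _ _ _).1[k [e' d]]; rewrite -!(lgM G e').
  apply: lim_dist_leg; rewrite (addf_oppm (tf_add _)) tf_suspm.
  exact: (tr_rot (tc_axioms (D k)) (tf_triangle _ t)).1 d.
apply/lim_dist_leg/(tr_rot (tc_axioms (D k)) (tf_triangle _ t)).2.
by rewrite -tf_suspm -(addf_oppm (tf_add _)).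
Qed.

Lemma lim_tr_mor u v w u' v' w' f g :
  lim_dist u v w -> lim_dist u' v' w' ->
  hom (dom u) (dom u') f -> hom (dom v) (dom v') g -> g ∘ u = u' ∘ f ->
  exists h, [/\ hom (dom w) (dom w') h, h ∘ v = v' ∘ g
              & fmor lim_susp f ∘ w = w' ∘ h].
Proof.
have [i [s es]] := liftMs [:: u; v; w; u'; v'; w'; f; g].
case: s es => [|u0 [|v0 [|w0 [|u1 [|v1 [|w1 [|f0 [|g0 [|]]]]]]]]] //.
move=> [-> -> -> -> -> -> -> ->] d d' hf hg sq.
(* [lifts_square] asks for composability; it comes from the shape of the first triangle and the
   endpoints of [f] and [g]. *)
have sq' : [/\ dom (fmor (G i) g0) = cod (fmor (G i) u0),
               dom (fmor (G i) u1) = cod (fmor (G i) f0)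
             & fmor (G i) g0 ∘ fmor (G i) u0 = fmor (G i) u1 ∘ fmor (G i) f0].
  have [t _ _] := lim_triangle d.
  by split=> //; [rewrite hg.1 t | rewrite hf.2].
rewrite !(dom_fmor (G i)) in hf hg.
have [j [e [[{}d {}d' {sq sq'}[_ _ sq]] [{}hf {}hg]]]] := (lifts_and I_filt
  (lifts_and3 I_filt (lifts_dist _ _ _) (lifts_dist _ _ _)
     (lifts_square I_filt G _ _ _ _))
  (lifts_and I_filt (lifts_hom I_filt G _ _ _) (lifts_hom I_filt G _ _ _))).1
  (conj (And3 d d' sq') (conj hf hg)).
rewrite -!dom_fmor in hf hg; rewrite -!(lgM G e).
have [h [hh e1 e2]] := tr_mor (tc_axioms (D j)) d d' hf hg sq.
have [t1 t2 t3] := tr_triangle (tc_axioms (D j)) d.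
have [t1' t2' t3'] := tr_triangle (tc_axioms (D j)) d'.
exists (fmor (G j) h); rewrite !(dom_fmor (G j)) lim_suspM.
rewrite -!(fmor_comp (G j)) ?e1 ?e2//.
- by split=> //; exact: hom_fmorE.
- by rewrite hh.2.
- by rewrite dom_fmor hf.1 t3.
- by rewrite hg.2.
- by rewrite hh.1.
Qed.

Lemma lim_tr_octahedron (u v j k l i m n : Mor C) :
  dom v = cod u ->
  lim_dist u j k -> lim_dist v l i -> lim_dist (v ∘ u) m n ->
  exists f g,
    [/\ lim_dist f g (fmor lim_susp j ∘ i),
        f ∘ j = m ∘ v, n ∘ f = k, g ∘ m = l & i ∘ g = fmor lim_susp u ∘ n].
Proof.
have [x [s es]] := liftMs [:: u; v; j; k; l; i; m; n].
case: s es => [|u0 [|v0 [|j0 [|k0 [|l0 [|i0 [|m0 [|n0 [|]]]]]]]]] //.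
move=> [-> -> -> -> -> -> -> ->] c d1 d2 d3.
(* Two rounds are needed: [v ∘ u] is the image of a composite only once [u] and [v] are composable
   at stage [y], and only then can the third triangle be lifted, to [z]. *)
have {c d1 d2} [y [e [c d1 d2]]] := (lifts_and3 I_filt (lifts_dom_cod G _ _)
  (lifts_dist _ _ _) (lifts_dist _ _ _)).1 (And3 c d1 d2).
rewrite -!(lgM G e) in d3 *; rewrite -(fmor_comp (G y))// in d3.
have {d3} [z [e' d3]] := (lifts_dist _ _ _).1 d3.
rewrite (fmor_comp (dgf D e'))// in d3.
have {}c : dom (fmor (dgf D e') (fmor (dgf D e) v0))
  = cod (fmor (dgf D e') (fmor (dgf D e) u0)).
  by rewrite (dom_fmor (dgf D e')) (cod_fmor (dgf D e')) c.
have {}d1 := tf_dist (dgf D e') d1; have {}d2 := tf_dist (dgf D e') d2.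
rewrite -!(lgM G e'); move: c d1 d2 d3.
move: (fmor _ (fmor _ u0)) (fmor _ (fmor _ v0)) (fmor _ (fmor _ j0))
  (fmor _ (fmor _ k0)) (fmor _ (fmor _ l0)) (fmor _ (fmor _ i0))
  (fmor _ (fmor _ m0)) (fmor _ (fmor _ n0)).
move=> {u v j k l i m n u0 v0 j0 k0 l0 i0 m0 n0}.
move=> u v j k l i m n c d1 d2 d3.
have [f [g [d4 e1 e2 e3 e4]]] := tr_octahedron (tc_axioms (D z)) c d1 d2 d3.
have [a1 a2 a3] := tr_triangle (tc_axioms (D z)) d1.
have [b1 b2 b3] := tr_triangle (tc_axioms (D z)) d2.
have [c1 c2 c3] := tr_triangle (tc_axioms (D z)) d3.
have [f1 f2 _] := tr_triangle (tc_axioms (D z)) d4.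
rewrite cod_comp// in c1; rewrite dom_comp// in c3.
have ji : dom (fmor susp j) = cod i by rewrite dom_fmor -a1 -c b3.
have un : dom (fmor susp u) = cod n by rewrite dom_fmor c3.
rewrite dom_comp// in f2.
(* The composability of [f] and [g] with the other maps is not part of the
   axiom, but follows from its last and third equations. *)
have gm : dom g = cod m.
  by rewrite c2 -(dom_comp un) -e4 dom_comp// f2.
have nf : dom n = cod f by rewrite -c2 -gm.
have fj : dom f = cod j by rewrite -(dom_comp nf) e2.
exists (fmor (G z) f), (fmor (G z) g).
rewrite !lim_suspM -!(fmor_comp (G z)) ?e1 ?e2 ?e3 ?e4//; split=> //.
exact: lim_dist_leg.
Qed.

Lemma lim_triangulated : triangulated lim_susp lim_dist.
Proof.
split.
- move=> f g; have [i [f0 [g0 [-> ->]]]] := lift2M I_filt G f g.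
  move=> /(lifts_parallel I_filt G _ _).1[j [u p]]; rewrite -!(lgM G u).
  rewrite -(G_add p) !lim_suspM (tr_susp_additive (tc_axioms (D j)) p) G_add//.
  exact: parallel_fmor.
- exact: lim_susp_equivalence.
- exact: lim_triangle.
- exact: lim_tr_iso.
- move=> a z; have [i [a0 [z0 [-> ->]]]] := lift2O I_filt G a z.
  move=> /(lifts_zero_object G_add _).1[j [e zz]]; rewrite -!(lgO G e).
  rewrite lim_suspO -!(addf_zerom (@G_add j)) -fmor_idm.
  by apply: lim_dist_leg; exact: tr_id (tc_axioms _) _ _ zz.
- move=> u; have [i [u0 ->]] := lg_surjM G u.
  have [v [w d]] := tr_cone (tc_axioms (D i)) u0.
  by exists (fmor (G i) v), (fmor (G i) w); exact: lim_dist_leg.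
- exact: lim_tr_rot.
- exact: lim_tr_mor.
- exact: lim_tr_octahedron.
Qed.

Definition lim_tri : tricat := TriCat lim_triangulated.

End TriangulatedColimit.

(** * The tensor product *)

Section TensorDomains.
Variable T : ttcat.
Implicit Types (a b c : Ob T) (f g : Mor T).
Let mon := tt_monoidal T.

Lemma dom_tensm f g : dom (f ⊗m g) = dom f ⊗ dom g.
Proof. by have [] := hom_tensm mon f g. Qed.
Lemma cod_tensm f g : cod (f ⊗m g) = cod f ⊗ cod g.
Proof. by have [] := hom_tensm mon f g. Qed.
Lemma dom_assoc a b c : dom (assoc (tt_tens T) a b c) = a ⊗ b ⊗ c.
Proof. by have [[]] := isom_assoc mon a b c. Qed.
Lemma cod_assoc a b c : cod (assoc (tt_tens T) a b c) = a ⊗ (b ⊗ c).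
Proof. by have [[]] := isom_assoc mon a b c. Qed.
Lemma dom_lunit a : dom (lunit (tt_tens T) a) = 𝟙 ⊗ a.
Proof. by have [[]] := isom_lunit mon a. Qed.
Lemma cod_lunit a : cod (lunit (tt_tens T) a) = a.
Proof. by have [[]] := isom_lunit mon a. Qed.
Lemma dom_runit a : dom (runit (tt_tens T) a) = a ⊗ 𝟙.
Proof. by have [[]] := isom_runit mon a. Qed.
Lemma cod_runit a : cod (runit (tt_tens T) a) = a.
Proof. by have [[]] := isom_runit mon a. Qed.
Lemma dom_braid a b : dom (braid (tt_tens T) a b) = a ⊗ b.
Proof. by have [[]] := isom_braid mon a b. Qed.
Lemma cod_braid a b : cod (braid (tt_tens T) a b) = b ⊗ a.
Proof. by have [[]] := isom_braid mon a b. Qed.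
Lemma dom_suspl a b : dom (suspl a b) = fob susp a ⊗ b.
Proof. by have [[]] := isom_sl (tt_biexact T) a b. Qed.
Lemma cod_suspl a b : cod (suspl a b) = fob susp (a ⊗ b).
Proof. by have [[]] := isom_sl (tt_biexact T) a b. Qed.
Lemma dom_suspr a b : dom (suspr a b) = a ⊗ fob susp b.
Proof. by have [[]] := isom_sr (tt_biexact T) a b. Qed.
Lemma cod_suspr a b : cod (suspr a b) = fob susp (a ⊗ b).
Proof. by have [[]] := isom_sr (tt_biexact T) a b. Qed.

End TensorDomains.

(** Rewriting with this bundle settles the composability side conditions in the coherence axioms. *)
Definition domE := (dom_tensm, cod_tensm, dom_assoc, cod_assoc, dom_lunit,
  cod_lunit, dom_runit, cod_runit, dom_braid, cod_braid, dom_suspl, cod_suspl,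
  dom_suspr, cod_suspr, dom_idm, cod_idm).

Section TensorColimit.
Variables (I : category) (I_filt : filtered I) (D : diagram I).
Variables (C : tricat) (G : cat_colimit D C).
Hypothesis G_add : forall i, additive_functor (G i).
Hypothesis G_suspO : forall i (a : Ob (D i)),
  fob susp (fob (G i) a) = fob (G i) (fob susp a).
Hypothesis G_suspM : forall i (f : Mor (D i)),
  fmor susp (fmor (G i) f) = fmor (G i) (fmor susp f).
Hypothesis G_dist : forall i (u v w : Mor (D i)), dist u v w ->
  dist (fmor (G i) u) (fmor (G i) v) (fmor (G i) w).
Hypothesis G_lift_dist : forall i (u v w : Mor (D i)),
  dist (fmor (G i) u) (fmor (G i) v) (fmor (G i) w) -> exists j (e : arr i j),
  dist (fmor (dgf D e) u) (fmor (dgf D e) v) (fmor (dgf D e) w).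
Implicit Types i j k l : Ob I.

Let cO := ob_cone I_filt G.
Let cM := mor_cone I_filt G.
Local Notation "c ** d" := (prod_cone I_filt c d)
  (at level 40, left associativity).
Local Notation "X **s Y" := (prod_sys X Y) (at level 40, left associativity).
Let sO := ob_sys D.
Let sM := mor_sys D.

Definition lim_tens (a b : Ob C) : Ob C :=
  ext (c := cO ** cO) (fun _ _ => True)
    (fun i (p : (sO **s sO) i) => fob (G i) (p.1 ⊗ p.2)) (a, b).
Definition lim_tensm (f g : Mor C) : Mor C :=
  ext (c := cM ** cM) (fun _ _ => True)
    (fun i (p : (sM **s sM) i) => fmor (G i) (p.1 ⊗m p.2)) (f, g).
Definition lim_unit : Ob C :=
  fob (G (sval (cid (filt_inhabited I_filt)))) 𝟙.
Definition lim_assoc (a b c : Ob C) : Mor C :=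
  ext (c := cO ** cO ** cO) (fun _ _ => True)
    (fun i (p : (sO **s sO **s sO) i) =>
       fmor (G i) (assoc (tt_tens (D i)) p.1.1 p.1.2 p.2)) (a, b, c).
Definition lim_lunit (a : Ob C) : Mor C :=
  ext (c := cO) (fun _ _ => True)
    (fun i (a : sO i) => fmor (G i) (lunit (tt_tens (D i)) a)) a.
Definition lim_runit (a : Ob C) : Mor C :=
  ext (c := cO) (fun _ _ => True)
    (fun i (a : sO i) => fmor (G i) (runit (tt_tens (D i)) a)) a.
Definition lim_braid (a b : Ob C) : Mor C :=
  ext (c := cO ** cO) (fun _ _ => True)
    (fun i (p : (sO **s sO) i) =>
       fmor (G i) (braid (tt_tens (D i)) p.1 p.2)) (a, b).
Definition lim_suspl (a b : Ob C) : Mor C :=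
  ext (c := cO ** cO) (fun _ _ => True)
    (fun i (p : (sO **s sO) i) => fmor (G i) (suspl p.1 p.2)) (a, b).
Definition lim_suspr (a b : Ob C) : Mor C :=
  ext (c := cO ** cO) (fun _ _ => True)
    (fun i (p : (sO **s sO) i) => fmor (G i) (suspr p.1 p.2)) (a, b).

Lemma lim_tensE i (a b : Ob (D i)) :
  lim_tens (fob (G i) a) (fob (G i) b) = fob (G i) (a ⊗ b).
Proof.
apply: (@extE _ _ (cO ** cO) _ _ _ _ i (a, b)) => //= j k u p _ /=.
by rewrite -tf_tens lgO.
Qed.

Lemma lim_tensmE i (f g : Mor (D i)) :
  lim_tensm (fmor (G i) f) (fmor (G i) g) = fmor (G i) (f ⊗m g).
Proof.
apply: (@extE _ _ (cM ** cM) _ _ _ _ i (f, g)) => //= j k u p _ /=.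
by rewrite -tf_tensm lgM.
Qed.

(** Transition functors preserve the unit strictly, so the units of any two stages agree at a common
    later one and the choice of stage is immaterial. *)
Lemma lim_unitE i : lim_unit = fob (G i) 𝟙.
Proof.
rewrite /lim_unit; case: cid => j /= _.
have [k [u [v _]]] := arr_join I_filt i j.
by rewrite -(lgO G u) -(lgO G v) !tf_unit.
Qed.

Lemma lim_assocE i (a b c : Ob (D i)) :
  lim_assoc (fob (G i) a) (fob (G i) b) (fob (G i) c)
  = fmor (G i) (assoc (tt_tens (D i)) a b c).
Proof.
apply: (@extE _ _ (cO ** cO ** cO) _ _ _ _ i (a, b, c)) => //= j k u p _ /=.
by rewrite -tf_assoc lgM.
Qed.

Lemma lim_lunitE i (a : Ob (D i)) :
  lim_lunit (fob (G i) a) = fmor (G i) (lunit (tt_tens (D i)) a).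
Proof.
apply: (@extE _ _ cO _ _ _ _ i a) => //= j k u p _ /=.
by rewrite -tf_lunit lgM.
Qed.

Lemma lim_runitE i (a : Ob (D i)) :
  lim_runit (fob (G i) a) = fmor (G i) (runit (tt_tens (D i)) a).
Proof.
apply: (@extE _ _ cO _ _ _ _ i a) => //= j k u p _ /=.
by rewrite -tf_runit lgM.
Qed.

Lemma lim_braidE i (a b : Ob (D i)) :
  lim_braid (fob (G i) a) (fob (G i) b)
  = fmor (G i) (braid (tt_tens (D i)) a b).
Proof.
apply: (@extE _ _ (cO ** cO) _ _ _ _ i (a, b)) => //= j k u p _ /=.
by rewrite -tf_braid lgM.
Qed.

Lemma lim_susplE i (a b : Ob (D i)) :
  lim_suspl (fob (G i) a) (fob (G i) b) = fmor (G i) (suspl a b).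
Proof.
apply: (@extE _ _ (cO ** cO) _ _ _ _ i (a, b)) => //= j k u p _ /=.
by rewrite -tf_suspl lgM.
Qed.

Lemma lim_susprE i (a b : Ob (D i)) :
  lim_suspr (fob (G i) a) (fob (G i) b) = fmor (G i) (suspr a b).
Proof.
apply: (@extE _ _ (cO ** cO) _ _ _ _ i (a, b)) => //= j k u p _ /=.
by rewrite -tf_suspr lgM.
Qed.

Definition lim_tensor_data : tensor_data C :=
  TensorData lim_tens lim_tensm lim_unit lim_assoc lim_lunit lim_runit
    lim_braid.

Let limE := (lim_tensE, lim_tensmE, lim_assocE, lim_lunitE, lim_runitE,
  lim_braidE, lim_susplE, lim_susprE).
Let mon i := tt_monoidal (D i).
Let biex i := tt_biexact (D i).

Lemma idm_leg i (a : Ob (D i)) : idm (fob (G i) a) = fmor (G i) (idm a).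
Proof. by rewrite fmor_idm. Qed.

Lemma lim_symmetric_monoidal : symmetric_monoidal lim_tensor_data.
Proof.
split=> /=.
- move=> f g; have [i [f0 [g0 [-> ->]]]] := lift2M I_filt G f g.
  rewrite !(dom_fmor, cod_fmor) !limE.
  by apply: hom_fmorE; exact: hom_tensm (mon i) _ _.
- move=> a b; have [i [a0 [b0 [-> ->]]]] := lift2O I_filt G a b.
  by rewrite !idm_leg !limE idm_leg (tensm_idm (mon i)).
- move=> g f g' f'.
  have [i [g0 [f0 [g1 [f1 [-> -> -> ->]]]]]] := lift4M I_filt G g f g' f'.
  move=> e e'; have [j [u [{}e {}e']]] := (lifts_and I_filt
    (lifts_dom_cod G _ _) (lifts_dom_cod G _ _)).1 (conj e e').
  rewrite -!(lgM G u) -!(fmor_comp (G j))// !limE -(fmor_comp (G j)).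
    by rewrite (tensm_comp (mon j)).
  by rewrite !domE e e'.
- move=> a b c; have [i [a0 [b0 [c0 [-> -> ->]]]]] := lift3O I_filt G a b c.
  by rewrite !limE; apply: isom_fmorE; exact: isom_assoc (mon i) _ _ _.
- move=> a; have [i [a0 ->]] := lg_surjO G a.
  by rewrite (lim_unitE i) !limE;
    apply: isom_fmorE; exact: isom_lunit (mon i) _.
- move=> a; have [i [a0 ->]] := lg_surjO G a.
  by rewrite (lim_unitE i) !limE;
    apply: isom_fmorE; exact: isom_runit (mon i) _.
- move=> a b; have [i [a0 [b0 [-> ->]]]] := lift2O I_filt G a b.
  by rewrite !limE; apply: isom_fmorE; exact: isom_braid (mon i) _ _.
- move=> f g h; have [i [f0 [g0 [h0 [-> -> ->]]]]] := lift3M I_filt G f g h.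
  rewrite !(dom_fmor (G i), cod_fmor (G i)) !limE.
  by rewrite -!(fmor_comp (G i)) ?domE// (nat_assoc (mon i)).
- move=> f; have [i [f0 ->]] := lg_surjM G f.
  rewrite !(dom_fmor (G i), cod_fmor (G i)) (lim_unitE i) !idm_leg !limE.
  by rewrite -!(fmor_comp (G i)) ?domE// (nat_lunit (mon i)).
- move=> f; have [i [f0 ->]] := lg_surjM G f.
  rewrite !(dom_fmor (G i), cod_fmor (G i)) (lim_unitE i) !idm_leg !limE.
  by rewrite -!(fmor_comp (G i)) ?domE// (nat_runit (mon i)).
- move=> f g; have [i [f0 [g0 [-> ->]]]] := lift2M I_filt G f g.
  rewrite !(dom_fmor (G i), cod_fmor (G i)) !limE.
  by rewrite -!(fmor_comp (G i)) ?domE// (nat_braid (mon i)).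
- move=> a b c d.
  have [i [a0 [b0 [c0 [d0 [-> -> -> ->]]]]]] := lift4O I_filt G a b c d.
  rewrite !idm_leg !limE -!(fmor_comp (G i)) ?(pentagon (mon i))//;
  by rewrite ?dom_comp !domE.
- move=> a b; have [i [a0 [b0 [-> ->]]]] := lift2O I_filt G a b.
  rewrite (lim_unitE i) !idm_leg !limE -!(fmor_comp (G i)).
    by rewrite (unit_triangle (mon i)).
  by rewrite !domE.
- move=> a b c; have [i [a0 [b0 [c0 [-> -> ->]]]]] := lift3O I_filt G a b c.
  rewrite !idm_leg !limE -!(fmor_comp (G i)) ?(hexagon (mon i))//;
  by rewrite ?dom_comp !domE.
- move=> a b; have [i [a0 [b0 [-> ->]]]] := lift2O I_filt G a b.
  rewrite !limE -!(fmor_comp (G i)) ?domE//.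
  by rewrite (braid_sym (mon i)) idm_leg.
Qed.

Lemma lim_biexact : biexact lim_tensor_data lim_suspl lim_suspr.
Proof.
split=> /=.
- move=> f f' g.
  have [i [f0 [f1 [g0 [-> -> ->]]]]] := lift3M I_filt G f f' g.
  move=> /(lifts_parallel I_filt G _ _).1[j [u p]]; rewrite -!(lgM G u).
  have p' h : parallel (fmor (dgf D u) f0 ⊗m h) (fmor (dgf D u) f1 ⊗m h).
    by case: p => p1 p2; split; rewrite !domE ?p1 ?p2.
  by rewrite -G_add// !limE -G_add// (tensm_addl (biex j)).
- move=> g f f'.
  have [i [g0 [f0 [f1 [-> -> ->]]]]] := lift3M I_filt G g f f'.
  move=> /(lifts_parallel I_filt G _ _).1[j [u p]]; rewrite -!(lgM G u).
  have p' h : parallel (h ⊗m fmor (dgf D u) f0) (h ⊗m fmor (dgf D u) f1).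
    by case: p => p1 p2; split; rewrite !domE ?p1 ?p2.
  by rewrite -G_add// !limE -G_add// (tensm_addr (biex j)).
- move=> a b; have [i [a0 [b0 [-> ->]]]] := lift2O I_filt G a b.
  rewrite !limE !G_suspO !limE.
  by apply: isom_fmorE; exact: isom_sl (biex i) _ _.
- move=> a b; have [i [a0 [b0 [-> ->]]]] := lift2O I_filt G a b.
  rewrite !limE !G_suspO !limE.
  by apply: isom_fmorE; exact: isom_sr (biex i) _ _.
- move=> f g; have [i [f0 [g0 [-> ->]]]] := lift2M I_filt G f g.
  rewrite !(dom_fmor (G i), cod_fmor (G i)) G_suspM !limE G_suspM.
  by rewrite -!(fmor_comp (G i)) ?(nat_sl (biex i))// !domE
    ?(dom_fmor susp, cod_fmor susp, domE).
- move=> f g; have [i [f0 [g0 [-> ->]]]] := lift2M I_filt G f g.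
  rewrite !(dom_fmor (G i), cod_fmor (G i)) G_suspM !limE G_suspM.
  by rewrite -!(fmor_comp (G i)) ?(nat_sr (biex i))// !domE
    ?(dom_fmor susp, cod_fmor susp, domE).
- move=> u v w b; have [i [u0 [v0 [w0 [-> -> ->]]]]] := lift3M I_filt G u v w.
  have [j [x [b0 ->]]] := liftO_above I_filt G i b.
  (* The triangle becomes distinguished only at a later stage [k]; exactness of the tensor product
     is used there and transported by [G_dist]. *)
  rewrite -!(lgM G x) => /G_lift_dist[k [y d]].
  rewrite -!(lgM G y) -(lgO G y) (dom_fmor (G k)) !idm_leg !limE.
  have [_ _ e] := tr_triangle (tc_axioms (D k)) d.
  rewrite -(fmor_comp (G k)); last by rewrite !domE e.
  exact/G_dist/(dist_tensl (biex k)).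
- move=> b u v w; have [i [u0 [v0 [w0 [-> -> ->]]]]] := lift3M I_filt G u v w.
  have [j [x [b0 ->]]] := liftO_above I_filt G i b.
  rewrite -!(lgM G x) => /G_lift_dist[k [y d]].
  rewrite -!(lgM G y) -(lgO G y) (dom_fmor (G k)) !idm_leg !limE.
  have [_ _ e] := tr_triangle (tc_axioms (D k)) d.
  rewrite -(fmor_comp (G k)); last by rewrite !domE e.
  exact/G_dist/(dist_tensr (biex k)).
Qed.

Definition lim_tt : ttcat := TTCat lim_symmetric_monoidal lim_biexact.

Definition lim_tt_leg i : ttfunctor (D i) lim_tt.
Proof.
exists (G i : functor (D i) lim_tt) => //=.
- by move=> u v w; exact: G_dist.
- by move=> a b; rewrite lim_tensE.
- by move=> f g; rewrite lim_tensmE.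
- by rewrite (lim_unitE i).
- by move=> a b c; rewrite lim_assocE.
- by move=> a; rewrite lim_lunitE.
- by move=> a; rewrite lim_runitE.
- by move=> a b; rewrite lim_braidE.
- by move=> a b; rewrite lim_susplE.
- by move=> a b; rewrite lim_susprE.
Defined.

End TensorColimit.

(** * The universal property *)

Section TTFunctors.

Definition ttid (T : ttcat) : ttfunctor T T.
Proof. by exists (Functor (C := T) (D := T) (fob := id) (fmor := id)
  (fun=> erefl) (fun=> erefl) (fun=> erefl) (fun _ _ _ => erefl)). Defined.

Variables (R S T : ttcat) (K : ttfunctor S T) (H : ttfunctor R S).

Definition comp_functor : functor R T.
Proof.
exists (fun a => fob K (fob H a)) (fun f => fmor K (fmor H f)).
- by move=> f; rewrite !dom_fmor.
- by move=> f; rewrite !cod_fmor.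
- by move=> a; rewrite !fmor_idm.
- by move=> g f e; rewrite !fmor_comp// dom_fmor cod_fmor e.
Defined.

Definition ttcomp : ttfunctor R T.
Proof.
exists comp_functor => /=.
- by move=> f g p; rewrite /= !tf_add//; exact: parallel_fmor.
- by move=> a; rewrite !tf_susp.
- by move=> f; rewrite !tf_suspm.
- by move=> u v w d; do 2 apply: tf_dist.
- by move=> a b; rewrite !tf_tens.
- by move=> f g; rewrite !tf_tensm.
- by rewrite !tf_unit.
- by move=> a b c; rewrite !tf_assoc.
- by move=> a; rewrite !tf_lunit.
- by move=> a; rewrite !tf_runit.
- by move=> a b; rewrite !tf_braid.
- by move=> a b; rewrite !tf_suspl.
- by move=> a b; rewrite !tf_suspr.
Defined.

End TTFunctors.

Section UniversalProperty.
Variables (I : category) (I_filt : filtered I) (D : diagram I).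
Implicit Types i j k l : Ob I.

(* The colimit of the underlying categories and distinguished triangles. *)
Record concrete_colimit (T : ttcat) (f : cocone D T) : Prop := ConcreteColimit {
  cc_surjO : forall a, exists i a0, a = fob (f i) a0;
  cc_surjM : forall m, exists i m0, m = fmor (f i) m0;
  cc_eqO : forall i a b, fob (f i) a = fob (f i) b ->
    exists j (u : arr i j), fob (dgf D u) a = fob (dgf D u) b;
  cc_eqM : forall i m n, fmor (f i) m = fmor (f i) n ->
    exists j (u : arr i j), fmor (dgf D u) m = fmor (dgf D u) n;
  cc_dist : forall i u v w, dist (fmor (f i) u) (fmor (f i) v) (fmor (f i) w) ->
    exists j (e : arr i j),
      dist (fmor (dgf D e) u) (fmor (dgf D e) v) (fmor (dgf D e) w) }.

Definition cocone_colimit (T : ttcat) (f : cocone D T)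
  (hf : concrete_colimit f) : cat_colimit D T.
Proof.
exists (fun i => f i).
- by move=> i j u a; exact: cc_ob.
- by move=> i j u m; exact: cc_mor.
- exact: cc_surjO hf.
- exact: cc_surjM hf.
- exact: cc_eqO hf.
- exact: cc_eqM hf.
Defined.

Lemma concrete_colimit_exists :
  exists (T : ttcat) (f : cocone D T), concrete_colimit f.
Proof.
pose G0 := lim_cat_colimit I_filt D.
(* Each layer of structure leaves the underlying category unchanged up to conversion, so [G0] can be
   retyped over every one of them. *)
pose G1 : cat_colimit D (lim_preadd I_filt G0) := G0.
have G1_add i : additive_functor (G1 i) := lim_preadd_leg I_filt G0 (i := i).
pose G2 : cat_colimit D (lim_add I_filt G1_add) := G0.
have G2_add i : additive_functor (G2 i) := G1_add i.
pose G3 : cat_colimit D (lim_tri I_filt G2_add) := G0.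
have G3_dist i := @lim_dist_leg _ _ _ G2 i.
pose leg i := lim_tt_leg I_filt (G := G3) G2_add (lim_suspO I_filt G2)
  (lim_suspM I_filt G2) G3_dist
  (fun i u v w => (lifts_dist I_filt G2 (i := i) u v w).1) i.
have legO i j e (h : hom i j e) a :
  fob (leg j) (fob (dg_mor D h) a) = fob (leg i) a.
  exact: (lgO G0 (exist _ e h)).
have legM i j e (h : hom i j e) a :
  fmor (leg j) (fmor (dg_mor D h) a) = fmor (leg i) a.
  exact: (lgM G0 (exist _ e h)).
exists _, (Cocone legO legM); split.
- exact: (lg_surjO G0).
- exact: (lg_surjM G0).
- exact: (@lg_eqO _ _ _ G0).
- exact: (@lg_eqM _ _ _ G0).
- exact: (fun i u v w => (lifts_dist I_filt G2 (i := i) u v w).1).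
Qed.

Section Induced.
Variables (L : ttcat) (g : cocone D L) (hg : concrete_colimit g).
Variables (T : ttcat) (f : cocone D T).
Let G := cocone_colimit hg.

Let GE i : lg G i = g i :> functor (D i) L. Proof. by []. Qed.

Definition induced_ob : Ob L -> Ob T :=
  ext (c := ob_cone I_filt G) (fun _ _ => True)
    (fun i (a : ob_sys D i) => fob (f i) a).
Definition induced_mor : Mor L -> Mor T :=
  ext (c := mor_cone I_filt G) (fun _ _ => True)
    (fun i (m : mor_sys D i) => fmor (f i) m).

Lemma induced_obE i a : induced_ob (fob (g i) a) = fob (f i) a.
Proof.
apply: (@extE _ _ (ob_cone I_filt G) _ _ _ _ i a) => //= j k u b _.
exact: cc_ob.
Qed.

Lemma induced_morE i m : induced_mor (fmor (g i) m) = fmor (f i) m.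
Proof.
apply: (@extE _ _ (mor_cone I_filt G) _ _ _ _ i m) => //= j k u b _.
exact: cc_mor.
Qed.

Definition induced_functor : functor L T.
Proof.
exists induced_ob induced_mor.
- move=> m; have [i [m0 ->]] := cc_surjM hg m.
  by rewrite induced_morE !dom_fmor induced_obE.
- move=> m; have [i [m0 ->]] := cc_surjM hg m.
  by rewrite induced_morE !cod_fmor induced_obE.
- move=> a; have [i [a0 ->]] := cc_surjO hg a.
  by rewrite induced_obE -!fmor_idm induced_morE.
- move=> n m; have [i [n0 [m0 [-> ->]]]] := lift2M I_filt G n m.
  move=> /(lifts_dom_cod G _ _).1[j [u e]]; rewrite -!(lgM G u) !GE.
  by rewrite -fmor_comp// !induced_morE fmor_comp.
Defined.

(** Exactness rests on [cc_dist]: a distinguished triangle of [L] is the image of one at a stage,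
    which [f] preserves. *)
Definition induced : ttfunctor L T.
Proof.
exists induced_functor => /=.
- move=> m n; have [i [m0 [n0 [-> ->]]]] := lift2M I_filt G m n.
  move=> /(lifts_parallel I_filt G _ _).1[j [u e]]; rewrite -!(lgM G u) !GE /=.
  by rewrite -(tf_add (g j))// !induced_morE tf_add.
- move=> a; have [i [a0 ->]] := cc_surjO hg a.
  by rewrite -tf_susp !induced_obE tf_susp.
- move=> m; have [i [m0 ->]] := cc_surjM hg m.
  by rewrite -tf_suspm !induced_morE tf_suspm.
- move=> u v w; have [i [u0 [v0 [w0 [-> -> ->]]]]] := lift3M I_filt G u v w.
  move=> /(cc_dist hg)[j [e d]]; rewrite -!(lgM G e) !GE !induced_morE.
  exact: tf_dist.
- move=> a b; have [i [a0 [b0 [-> ->]]]] := lift2O I_filt G a b.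
  by rewrite !GE -tf_tens !induced_obE tf_tens.
- move=> a b; have [i [a0 [b0 [-> ->]]]] := lift2M I_filt G a b.
  by rewrite !GE -tf_tensm !induced_morE tf_tensm.
- have [i _] := filt_inhabited I_filt.
  by rewrite -(tf_unit (g i)) induced_obE tf_unit.
- move=> a b c; have [i [a0 [b0 [c0 [-> -> ->]]]]] := lift3O I_filt G a b c.
  by rewrite !GE -tf_assoc induced_morE !induced_obE tf_assoc.
- move=> a; have [i [a0 ->]] := cc_surjO hg a.
  by rewrite -tf_lunit induced_morE induced_obE tf_lunit.
- move=> a; have [i [a0 ->]] := cc_surjO hg a.
  by rewrite -tf_runit induced_morE induced_obE tf_runit.
- move=> a b; have [i [a0 [b0 [-> ->]]]] := lift2O I_filt G a b.
  by rewrite !GE -tf_braid induced_morE !induced_obE tf_braid.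
- move=> a b; have [i [a0 [b0 [-> ->]]]] := lift2O I_filt G a b.
  by rewrite !GE -tf_suspl induced_morE !induced_obE tf_suspl.
- move=> a b; have [i [a0 [b0 [-> ->]]]] := lift2O I_filt G a b.
  by rewrite !GE -tf_suspr induced_morE !induced_obE tf_suspr.
Defined.

Lemma induced_factors : factors g f induced.
Proof.
by move=> i; split=> [a|m]; [exact: induced_obE|exact: induced_morE].
Qed.

End Induced.

(** [T] is a retract of a concrete colimit [L]: uniqueness, applied to the cocone [f] itself, gives
    that [K] after [H] is the identity. Representatives found in [L] are pushed to [T] by [K], while
    equations and distinguished triangles of [T] are pushed to [L] by [H] and lifted there. *)
Lemma is_colimit_concrete (T : ttcat) (f : cocone D T) :
  is_colimit f -> concrete_colimit f.
Proof.
move=> fcol; have [L [g hg]] := concrete_colimit_exists.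
have [[H Hf] _] := fcol L g.
have [K Kf] : exists K : ttfunctor L T, factors g f K.
  by exists (induced hg f); exact: induced_factors.
have [KHO KHM] : fob (ttcomp K H) =1 fob (ttid T) /\
                 fmor (ttcomp K H) =1 fmor (ttid T).
  apply: (fcol T f).2 => i; split=> //= x.
    by rewrite (Hf i).1 (Kf i).1.
  by rewrite (Hf i).2 (Kf i).2.
split.
- move=> a; have [i [a0 e]] := cc_surjO hg (fob H a); exists i, a0.
  by rewrite -(Kf i).1 -e; exact: esym (KHO a).
- move=> m; have [i [m0 e]] := cc_surjM hg (fmor H m); exists i, m0.
  by rewrite -(Kf i).2 -e; exact: esym (KHM m).
- move=> i a b /(congr1 (fob H)); rewrite !(Hf i).1; exact: cc_eqO.
- move=> i m n /(congr1 (fmor H)); rewrite !(Hf i).2; exact: cc_eqM.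
- move=> i u v w /(tf_dist H); rewrite !(Hf i).2; exact: cc_dist.
Qed.

End UniversalProperty.

(** * Prime ideals *)

Section PrimeUnion.
Variables (I : category) (I_filt : filtered I) (D : diagram I).
Variables (T : ttcat) (f : cocone D T) (hf : concrete_colimit f).
Implicit Types i j k l : Ob I.
Let G := cocone_colimit hf.
Let GE i : lg G i = f i :> functor (D i) T. Proof. by []. Qed.
Let G_add i : additive_functor (G i) := tf_add (f i).

(** Closure of a union of primes under summands needs a decomposition in [T] to exist already at a
    stage. The three objects are read off as endpoints of the lifted maps. *)
Lemma lift_biproduct a b s : biproduct a b s -> exists i a0 b0 s0,
  [/\ a = fob (f i) a0, b = fob (f i) b0, s = fob (f i) s0
    & biproduct a0 b0 s0].
Proof.
move=> [i1 [i2 [p1 [p2]]]].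
have [i [j1 [j2 [q1 [q2 [-> -> -> ->]]]]]] := lift4M I_filt G i1 i2 p1 p2.
move=> [[<- <-] [<- hi2] [hp1 hp1'] [hp2 hp2'] e11 e22 e12 e21 ip].
have [|j [u [[{}hi2 {}hp1 {}hp2] [{}hp1' {}hp2']]]] := (lifts_and I_filt
  (lifts_and3 I_filt (lifts_cod_cod G j2 j1) (lifts_dom_cod G q1 j1)
    (lifts_dom_cod G q2 j1))
  (lifts_and I_filt (lifts_cod_ob G q1 (dom j1))
     (lifts_cod_ob G q2 (dom j2)))).1; first by rewrite -!(dom_fmor (G i)).
rewrite -!(dom_fmor (dgf D u)) in hp1' hp2'.
rewrite -!(lgM G u) in e11 e22 e12 e21 ip *.
move: hi2 hp1 hp2 hp1' hp2' e11 e22 e12 e21 ip.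
move: (fmor _ j1) (fmor _ j2) (fmor _ q1) (fmor _ q2).
move=> {i2 p1 p2 j1 j2 q1 q2}{}i1 i2 p1 p2 hi2 hp1 hp2 hp1' hp2'.
have h1 : hom (dom i1) (cod i1) i1 by [].
have h2 : hom (dom i2) (cod i1) i2 by [].
have h3 : hom (cod i1) (dom i1) p1 by [].
have h4 : hom (cod i1) (dom i2) p2 by [].
rewrite -!(fmor_comp (G j)) ?hi2// -(G_add (hom_parallel
  (hom_comp h1 h3) (hom_comp h2 h4))).
rewrite !(dom_fmor (G j)) !(cod_fmor (G j)) !idm_leg -!(addf_zerom (@G_add j)).
move=> e11 e22 e12 e21 ip.
have [k [v [[{}e11 {}e22] [{}e12 {}e21 {}ip]]]] := (lifts_and I_filt
  (lifts_and I_filt (lifts_eqM G _ _) (lifts_eqM G _ _))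
  (lifts_and3 I_filt (lifts_eqM G _ _) (lifts_eqM G _ _) (lifts_eqM G _ _))).1
  (conj (conj e11 e22) (And3 e12 e21 ip)).
exists k, (fob (dgf D v) (dom i1)), (fob (dgf D v) (dom i2)),
  (fob (dgf D v) (cod i1)).
split; [exact/esym/(lgO G)..|].
exists (fmor (dgf D v) i1), (fmor (dgf D v) i2), (fmor (dgf D v) p1),
  (fmor (dgf D v) p2).
split; try exact: hom_fmorE.
- by rewrite -fmor_comp// e11 fmor_idm.
- by rewrite -fmor_comp ?hi2// e22 fmor_idm.
- by rewrite -fmor_comp ?hi2// e12 fmor_zerom.
- by rewrite -fmor_comp// e21 fmor_zerom.
- rewrite -!fmor_comp// -(tf_add (dgf D v)) ?ip ?fmor_idm//.
  exact: hom_parallel (hom_comp h1 h3) (hom_comp h2 h4).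
Qed.

Variables (x : forall i, Spc (D i)) (hx : spc_lim x).

Definition prime_union : set (Ob T) :=
  [set t | exists i a, t = fob (f i) a /\ spc_set (x i) a].

Lemma spc_lim_tr i j (u : arr i j) a :
  spc_set (x j) (fob (dgf D u) a) <-> spc_set (x i) a.
Proof. by rewrite -(hx (proj2_sig u)). Qed.

(** If [a] has the same image as some [b] in [x j], the two agree at a common stage, and
    compatibility of the family moves membership up from [j] and back down to [i]. *)
Lemma prime_unionE i a : prime_union (fob (f i) a) <-> spc_set (x i) a.
Proof.
split=> [[j [b [ab xb]]]|xa]; last by exists i, a.
have [k [u [v uv]]] := leg_sep (c := ob_cone I_filt G) ab.
by apply/(spc_lim_tr u); rewrite [fob _ _]uv; apply/spc_lim_tr.
Qed.

Let xthick i : thick (x i) := ideal_thick (prime_ttideal (spc_prime (x i))).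

Lemma prime_union_prime : prime_ideal prime_union.
Proof.
split; first split; first split.
- move=> z; have [i [a ->]] := cc_surjO hf z.
  move=> /(lifts_zero_object G_add _).1[j [u z0]].
  rewrite -(lgO G u) GE; apply/prime_unionE; exact: (thick_zero (xthick j)).
- move=> a b m; have [i [a0 [b0 [-> ->]]]] := lift2O I_filt G a b.
  have [j [u [m0 ->]]] := liftM_above I_filt G i m.
  rewrite -!(lgO G u) => /(lifts_isom I_filt _ _ _ _).1[k [v hm]].
  rewrite -!(lgO G v) !GE => /prime_unionE xa; apply/prime_unionE.
  exact: (thick_iso (xthick k) hm).
- move=> a; have [i [a0 ->]] := cc_surjO hf a; rewrite -tf_susp.
  by split=> /prime_unionE/(thick_susp (xthick i)) xa; apply/prime_unionE.
- move=> u v w; have [i [u0 [v0 [w0 [-> -> ->]]]]] := lift3M I_filt G u v w.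
  move=> /(cc_dist hf)[j [e d]]; rewrite -!(lgM G e) !GE !(dom_fmor (f j)).
  rewrite !(cod_fmor (f j)) => /prime_unionE xu /prime_unionE xv.
  by apply/prime_unionE; exact: (thick_cone (xthick j) d).
- move=> a b s /lift_biproduct[i [a0 [b0 [s0 [-> -> -> B]]]]] /prime_unionE xs.
  by have [xa xb] := thick_summand (xthick i) B xs; split; apply/prime_unionE.
- move=> a b; have [i [a0 [b0 [-> ->]]]] := lift2O I_filt G a b.
  rewrite !GE -tf_tens => /prime_unionE xb; apply/prime_unionE.
  exact: (ideal_tens (prime_ttideal (spc_prime (x i)))).
(* One stage suffices for properness: by [prime_unionE], an object outside [x i] has its image
   outside the union. *)
- have [i _] := filt_inhabited I_filt.
  have [a na] := prime_proper (spc_prime (x i)).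
  by exists (fob (f i) a) => /prime_unionE.
- move=> a b; have [i [a0 [b0 [-> ->]]]] := lift2O I_filt G a b.
  rewrite !GE -tf_tens => /prime_unionE /(prime_tens (spc_prime (x i)))[xa|xb].
    by left; apply/prime_unionE.
  by right; apply/prime_unionE.
Qed.

End PrimeUnion.

(** * Topology of spectra and of their limit *)

Lemma spc_openE (T : ttcat) : @open (Spc T) = @spc_open T.
Proof. by []. Qed.

Lemma spc_map_continuous (S T : ttcat) (F : ttfunctor S T) :
  continuous (spc_map F).
Proof.
apply/continuousP => O; rewrite !spc_openE => oO P /oO[a [Pa aO]].
exists (fob F a); split=> // Q Qa; exact: aO.
Qed.

Lemma open_spcU (T : ttcat) (a : Ob T) : open (@spcU T a).
Proof. by rewrite spc_openE => P Pa; exists a; split=> // Q. Qed.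

(** The product topology is the supremum of the initial topologies of the projections, so it refines
    the one that makes the projection at [j] continuous. *)
Lemma prod_topology_proj_continuous (J : Type) (K : J -> topologicalType) j :
  continuous (fun y : prod_topology K => y j).
Proof.
move=> y U nU; have /cvg_sup/(_ j) : y --> y by exact: cvg_id.
apply; exact: (@initial_continuous _ _ (fun z : forall j, K j => z j)).
Qed.

Lemma continuous_prod_topology (J : Type) (K : J -> topologicalType)
    (X : topologicalType) (h : X -> prod_topology K) :
  (forall j, continuous (fun z => h z j)) -> continuous h.
Proof.
move=> ch z; apply/cvg_sup => j; move: z.
exact: (@continuous_comp_initial _ _ _ (fun y : forall j, K j => y j)).
Qed.

Theorem proposition8p2 (I : category) (I_filtered : filtered I)
    (D : diagram I) (T : ttcat) (f : cocone D T) (f_colim : is_colimit f) :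
  homeomorphism (spc_phi f).
Proof.
have hf := is_colimit_concrete I_filtered f_colim.
pose g (y : set_type (spc_lim (D := D))) : Spc T :=
  MkSpc (prime_union_prime I_filtered hf (set_valP y)).
have gE (y : set_type (spc_lim (D := D))) i a :
    spc_set (g y) (fob (f i) a) <-> spc_set (val y i) a.
  exact: (prime_unionE I_filtered hf (set_valP y)).
split.
  (* The limit carries the subspace topology, which is initial for the inclusion into the product,
     so continuity is tested after that inclusion. *)
  apply: continuous_comp_initial.
  apply: continuous_prod_topology => i; exact: spc_map_continuous.
exists g; split.
- apply/continuousP => O; rewrite spc_openE openE => oO y /oO[t [yt tO]].
  have [i [a ta]] := cc_surjO hf t.
  rewrite /= in yt *; rewrite {t}ta in yt tO.
  (* Whether the object lies in [g z] depends on coordinate [i] alone, so [g] maps the cylinder over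
     [spcU a] into [O]; it remains to see that this cylinder is a neighbourhood of [y]. *)
  apply: (@filterS _ _ _ ((fun z => val z i) @^-1` (@spcU (D i) a))).
    by move=> z /= za; apply: tO; apply/gE.
  pose p (z : prod_topology (fun i => Spc (D i))) := z i.
  have pc : continuous (p \o set_val (A := spc_lim (D := D))).
    move=> z; apply: continuous_comp; first exact: initial_continuous.
    exact: prod_topology_proj_continuous.
  by apply: pc; apply: open_nbhs_nbhs; split; [exact: open_spcU | apply/gE].
(* A prime of [T] is determined by its preimages, since every object of [T] comes from a stage. *)
- move=> P; apply/Spc_ext/funext => t; apply/propext.
  by have [i [a ->]] := cc_surjO hf t; rewrite gE.
- move=> y; apply/val_inj/functional_extensionality_dep => i.
  by apply/Spc_ext/funext => a; apply/propext; exact: gE.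
Qed.
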